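(* Let $L\subset\mathbb{P}^n$ be a linear space of dimension $k$. If the point configuration $Z\subset\mathbb{P}W^*$ of $L$ lies on a unique quadric, of rank $s$, then $L^{\circ2}$ can set-theoretically be described as the vanishing set of $n-\binom{k+2}{2}+2$ linear forms and - $(k+3)(k+2)(k+1)(k-2)/12$ quadratic forms, if $s\ge4$; - $(k+3)(k+2)(k+1)(k-2)/12$ quadratic forms and $7$ cubic forms, if $s=3$; - $(k+3)(k+2)(k+1)(k-2)/12+2$ quadratic forms, if $s=2$.
   Context: We work over $\mathbb{C}$. $L^{\circ2}$ denotes the coordinate-wise square of $L$: the image of $L$ under the morphism $\varphi_2\colon\mathbb{P}^n\to\mathbb{P}^n$, $[x_0:\ldots:x_n]\mapsto[x_0^2:\ldots:x_n^2]$. The linear space $L$ is viewed as the image of a chosen linear embedding $[\ell_0:\ldots:\ell_n]\colon\mathbb{P}W\hookrightarrow\mathbb{P}^n$, where $W$ is a $(k+1)$-dimensional vector space and $\ell_0,\ldots,\ell_n\in W^*$ are linear forms; its point configuration is the finite set $Z:=\{[\ell_i]\in\mathbb{P}W^*\mid 0\le i\le n,\ \ell_i\ne0\}$, which spans $\mathbb{P}W^*$. ''$Z$ lies on a unique quadric of rank $s$'' means that the space of quadratic forms on $W^*$ (elements of $\mathrm{Sym}^2W$) vanishing on $Z$ is one-dimensional and spanned by a quadratic form of rank $s$ (necessarily $s\ge2$, since $Z$ spans $\mathbb{P}W^*$). *)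

(* Defs.v *)
From mathcomp Require Export all_boot all_order all_algebra.
From mathcomp Require Export reals complex.
From mathcomp Require Export mpoly.

Set Implicit Arguments.
Unset Strict Implicit.
Unset Printing Implicit Defensive.

Import GRing.Theory.
Local Open Scope ring_scope.

(* A subset of P^m over C is given by the predicate on row vectors that holds
   of exactly the nonzero representatives of its points.  A linear subspace of
   P^n of dimension k is given by its cone, a subspace of C^(n+1) of
   dimension k+1. *)

Section Definitions.

Variable C : numClosedFieldType.
Variables n k : nat.

(* The map [x_0 : ... : x_n] |-> [x_0^2 : ... : x_n^2] on representatives. *)
Definition phi2 (x : 'rV[C]_n.+1) : 'rV[C]_n.+1 := \row_i x 0 i ^+ 2.

Definition coord_square (L : {vspace 'rV[C]_n.+1}) (y : 'rV[C]_n.+1) : Prop :=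
  exists x, [/\ x \in L, x != 0 & exists2 c, c != 0 & y = c *: phi2 x].

(* W is C^(k+1), written as columns, and its dual W^* consists of rows: the
   value of the linear form l at w is the entry of l *m w. *)
Definition embed (ell : 'I_n.+1 -> 'rV[C]_k.+1) (w : 'cV[C]_k.+1) :
    'rV[C]_n.+1 :=
  \row_i (ell i *m w) 0 0.

Definition linear_embedding_onto (L : {vspace 'rV[C]_n.+1})
    (ell : 'I_n.+1 -> 'rV[C]_k.+1) : Prop :=
  injective (embed ell) /\ forall x, x \in L <-> exists w, x = embed ell w.

Definition point_configuration (ell : 'I_n.+1 -> 'rV[C]_k.+1)
    (p : 'rV[C]_k.+1) : Prop :=
  exists2 i, ell i != 0 & exists2 c, c != 0 & p = c *: ell i.

(* Elements of Sym^2 W are symmetric matrices Q, with associated quadratic form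
   l |-> l Q l^T on W^*; the rank of the form is the rank of Q. *)
Definition quadric_contains (Q : 'M[C]_k.+1) (Z : 'rV[C]_k.+1 -> Prop) : Prop :=
  forall p, Z p -> (p *m Q *m p^T) 0 0 = 0.

Definition on_unique_quadric_of_rank (Z : 'rV[C]_k.+1 -> Prop) (s : nat) :
    Prop :=
  exists Q0 : 'M[C]_k.+1,
    [/\ Q0^T = Q0, Q0 != 0, \rank Q0 = s
      & forall Q : 'M[C]_k.+1, Q^T = Q ->
          (quadric_contains Q Z <-> exists c, Q = c *: Q0)].

Definition vanish_at (fs : seq {mpoly C[n.+1]}) (y : 'rV[C]_n.+1) : Prop :=
  forall f, f \in fs -> f.@[y 0] = 0.

(* The numbers of forms are rational so that the expressions substituted for
   them are read without truncated subtraction or rounded division; the size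
   equations in particular force them to be natural numbers. *)
Definition cut_out_by_forms (X : 'rV[C]_n.+1 -> Prop) (a b c : rat) : Prop :=
  exists lin quad cub : seq {mpoly C[n.+1]},
    [/\ [/\ (size lin)%:R = a, (size quad)%:R = b & (size cub)%:R = c],
        [/\ {in lin, forall f, f \is 1.-homog},
            {in quad, forall f, f \is 2.-homog}
          & {in cub, forall f, f \is 3.-homog}]
      & forall y : 'rV[C]_n.+1, y != 0 ->
          (X y <-> [/\ vanish_at lin y, vanish_at quad y & vanish_at cub y])].

End Definitions.

Definition num_linear (n k : nat) : rat := n%:R - 'C(k.+2, 2)%:R + 2%:R.

Definition num_quadratic (k : nat) : rat :=
  (k%:R + 3%:R) * (k%:R + 2%:R) * (k%:R + 1) * (k%:R - 2%:R) / 12%:R.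

(* Main.v *)
From HB Require Import structures.
Require Import Defs.
From mathcomp Require Import all_boot all_order all_algebra.
From mathcomp Require Import reals complex.
From mathcomp Require Import mpoly.
From mathcomp Require boolp.
From mathcomp Require Import ring.

Set Implicit Arguments.
Unset Strict Implicit.
Unset Printing Implicit Defensive.

Import GRing.Theory Num.Theory.
Local Open Scope ring_scope.

(** Let Q0 span the quadrics through Z.  The squares ell_i^2 span the hyperplane
    V = Q0^perp of Sym^2 W^*, so the point y satisfies the linear relations among
    the ell_i^2 iff y_i = A(ell_i, ell_i) for a symmetric matrix A, unique up to
    adding multiples of Q0, and y lies in L^{o2} iff some A + t Q0 is w^T w.

    The quadrics used are all the quadratic forms on V^* that vanish on the points
    w^T w, i.e. the kernel of Sym^2 V -> Sym^4 W^*.  When Q0 = x_1^2 + ... + x_s^2,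
    a direct computation with monomials shows that this map is onto for s >= 3 and
    has corank at most 2 for s = 2, which gives their number.  They contain
    A(x, z) A(y, w) - A(x, w) A(y, z) whenever Q0 vanishes on {x, y} x {z, w}, and
    for s >= 4 these orthogonal minors alone force A + t Q0 to have rank <= 1: if A
    vanishes on all Q0-isotropic vectors, A is a multiple of Q0; otherwise take x
    isotropic with A(x, x) <> 0 and show that A - t Q0 = A(x, .) A(., x) / A(x, x),
    first on the orthogonal complement of x and then everywhere.

    For s <= 3 the same minors settle the case where A does not vanish on the
    radical of Q0, and otherwise reduce the problem to an s x s block B with Q0 the
    identity.  For s = 2, subtract an eigenvalue.  For s = 3, the cubics say that
    I, B, B^2 are linearly dependent; then (B - a)(B - b) = 0 for some a and b, and
    one of the two factors has rank at most 1. *)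

(** * Symmetric matrices and bilinear forms *)

Section Bilinear.
Variable C : numClosedFieldType.

Definition bil m (A : 'M[C]_m) (x y : 'rV_m) : C := (x *m A *m y^T) 0 0.

Lemma bilDl m (A : 'M_m) x x' y : bil A (x + x') y = bil A x y + bil A x' y.
Proof. by rewrite /bil !mulmxDl mxE. Qed.

Lemma bilZl m (A : 'M_m) c x y : bil A (c *: x) y = c * bil A x y.
Proof. by rewrite /bil -!scalemxAl mxE. Qed.

Lemma bil_tr m (A : 'M_m) x y : bil A^T x y = bil A y x.
Proof.
rewrite /bil; have <- : (y *m A *m x^T)^T = x *m A^T *m y^T.
  by rewrite !trmx_mul trmxK mulmxA.
by rewrite mxE.
Qed.

Lemma bilC m (A : 'M_m) x y : A^T = A -> bil A x y = bil A y x.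
Proof. by move=> sA; rewrite -bil_tr sA. Qed.

Lemma bilDr m (A : 'M_m) x y y' : bil A x (y + y') = bil A x y + bil A x y'.
Proof. by rewrite -!(bil_tr A) bilDl. Qed.

Lemma bilZr m (A : 'M_m) c x y : bil A x (c *: y) = c * bil A x y.
Proof. by rewrite -!(bil_tr A) bilZl. Qed.

Lemma bilNl m (A : 'M_m) x y : bil A (- x) y = - bil A x y.
Proof. by rewrite -scaleN1r bilZl mulN1r. Qed.

Lemma bilNr m (A : 'M_m) x y : bil A x (- y) = - bil A x y.
Proof. by rewrite -scaleN1r bilZr mulN1r. Qed.

Definition bil_lin := (bilDl, bilDr, bilNl, bilNr, bilZl, bilZr).

Lemma bil_congr m p (K : 'M_(p, m)) (A : 'M_m) x y :
  bil (K *m A *m K^T) x y = bil A (x *m K) (y *m K).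
Proof. by rewrite /bil trmx_mul !mulmxA. Qed.

Lemma bil_mxD m (A B : 'M_m) x y : bil (A + B) x y = bil A x y + bil B x y.
Proof. by rewrite /bil mulmxDr mulmxDl mxE. Qed.

Lemma bil_mxZ m (A : 'M_m) c x y : bil (c *: A) x y = c * bil A x y.
Proof. by rewrite /bil -scalemxAr -scalemxAl mxE. Qed.

Lemma bil_mxB m (A B : 'M_m) x y : bil (A - B) x y = bil A x y - bil B x y.
Proof. by rewrite -scaleN1r bil_mxD bil_mxZ mulN1r. Qed.

Lemma bil_rank1 m (u v x y : 'rV_m) :
  bil (u^T *m v) x y = (x *m u^T) 0 0 * (v *m y^T) 0 0.
Proof. by rewrite /bil mulmxA -mulmxA mxE big_ord1. Qed.

Lemma bil_delta m (A : 'M_m) i j :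
  bil A (delta_mx 0 i) (delta_mx 0 j) = A i j.
Proof. by rewrite /bil trmx_delta -rowE -colE !mxE. Qed.

Lemma bil_inj m (A B : 'M_m) : (forall x y, bil A x y = bil B x y) -> A = B.
Proof. by move=> eAB; apply/matrixP=> i j; rewrite -!bil_delta. Qed.

Lemma bil_mulr m (A : 'M_m) x y : (x *m A *m y^T) = (bil A x y)%:M.
Proof. by rewrite /bil -mx11_scalar. Qed.

Definition symm_part m (B : 'M[C]_m) := 2%:R^-1 *: (B + B^T).

Lemma symm_part_sym m (B : 'M[C]_m) : (symm_part B)^T = symm_part B.
Proof. by rewrite linearZ linearD /= trmxK addrC. Qed.

Lemma bil_symm_part m (B : 'M[C]_m) x y :
  bil (symm_part B) x y = 2%:R^-1 * (bil B x y + bil B y x).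
Proof. by rewrite bil_mxZ bil_mxD bil_tr. Qed.

Lemma bil_symm_part_diag m (B : 'M[C]_m) x : bil (symm_part B) x x = bil B x x.
Proof. by rewrite bil_symm_part; field. Qed.

(** After scaling so that Q(z0, w0) = 1, suitable pairs on which Q vanishes determine N from the
    single value N(z0, w0). *)
Lemma bil_proportional m (N Q : 'M_m) :
    (forall z w, bil Q z w = 0 -> bil N z w = 0) -> exists t, N = t *: Q.
Proof.
move=> QN; have [Q0|nzQ] := eqVneq Q 0.
  exists 0; rewrite Q0 scaler0; apply/matrixP=> i j.
  by rewrite -bil_delta QN ?mxE // Q0 /bil mulmx0 mul0mx mxE.
have /matrix0Pn[i [j nzQij]] := nzQ.
have [z0 [w0 Q1]] : exists z0 w0, bil Q z0 w0 = 1.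
  exists ((Q i j)^-1 *: delta_mx 0 i), (delta_mx 0 j).
  by rewrite bilZl bil_delta mulVf.
have Nl z : bil N z w0 = bil Q z w0 * bil N z0 w0.
  have := QN (z - bil Q z w0 *: z0) w0; rewrite !bil_lin Q1 mulr1 subrr.
  by move/(_ erefl)/subr0_eq.
have Nr w : bil N z0 w = bil Q z0 w * bil N z0 w0.
  have := QN z0 (w - bil Q z0 w *: w0); rewrite !bil_lin Q1 mulr1 subrr.
  by move/(_ erefl)/subr0_eq.
exists (bil N z0 w0); apply: bil_inj => z w; rewrite bil_mxZ.
(* The multiple of [z0] subtracted below makes the first vector pair to -1 with [w0] under Q, so
   that [b] solves Q = 0 without a division. *)
pose b := bil Q z0 w - (bil Q z w - bil Q z w0 * bil Q z0 w).
have := QN (z - (bil Q z w0 + 1) *: z0) (w - b *: w0).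
rewrite !bil_lin (Nl z) (Nr w) Q1 => H; apply/subr0_eq; rewrite -[RHS]H /b; ring.
Qed.

(** Gram-Schmidt by induction on the size, with square roots available in C; the size of the
    identity block is the rank because congruence preserves rank. *)
Lemma congr_pid_mx m (Q : 'M[C]_m) : Q^T = Q ->
  exists2 P, P \in unitmx & P *m Q *m P^T = pid_mx (\rank Q).
Proof.
move=> sQ; suff [P uP [r le_rm defQ]] : exists2 P, P \in unitmx &
    exists2 r, (r <= m)%N & P *m Q *m P^T = pid_mx r.
  exists P => //; rewrite defQ; congr pid_mx.
  have := congr1 mxrank defQ; rewrite rank_pid_mx // => <-.
  rewrite mxrankMfree ?row_free_unit ?unitmx_tr // eqmxMfull //.
  by rewrite row_full_unit.
elim: m Q sQ => [|m IHm] Q sQ.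
  by exists 1%:M; [exact: unitmx1|exists 0%N => //; apply/matrixP => -[]].
have [Q0|nzQ] := eqVneq Q 0.
  exists 1%:M; first exact: unitmx1; exists 0%N => //.
  by rewrite Q0 mulmx0 mul0mx pid_mx_0.
have [v nzv] : exists v : 'rV_m.+1, bil Q v v != 0.
  (* If the diagonal of Q is zero, polarization gives Q(e_i + e_j, e_i + e_j) = 2 Q_ij. *)
  case: (pickP (fun i => Q i i != 0)) => [i Qii|Qd].
    by exists (delta_mx 0 i); rewrite bil_delta.
  have /matrix0Pn[i [j nzQij]] := nzQ.
  exists (delta_mx 0 i + delta_mx 0 j); rewrite !bil_lin !bil_delta.
  move: (Qd i) (Qd j) => /negbFE/eqP-> /negbFE/eqP->; rewrite addr0 add0r.
  have -> : Q j i = Q i j by rewrite -[in LHS]sQ mxE.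
  by rewrite -mulr2n mulrn_eq0.
have {v nzv} [v Qv] : exists v : 'rV_m.+1, bil Q v v = 1.
  exists ((sqrtC (bil Q v v))^-1 *: v).
  rewrite bilZl bilZr mulrA -invfM -expr2 sqrtCK mulVf //.
have nzv : v != 0.
  by apply: contra_eq_neq Qv => ->; rewrite /bil mul0mx mul0mx mxE eq_sym oner_eq0.
(* The matrix [f] sends e_0 to the nonzero vector v, so it agrees on e_0 with an invertible matrix,
   whose first row is then v. *)
have [B uB defv] : exists2 B : 'M[C]_(1 + m), B \in unitmx & v = usubmx B.
  pose d : 'rV[C]_(1 + m) := delta_mx 0 0.
  pose f : 'M[C]_(1 + m) := \matrix_i v.
  have df : d *m f = v by rewrite -rowE rowK.
  have := @complete_unitmx _ _ _ d f; rewrite df !rank_rV nzv.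
  have -> : d != 0 by apply/eqP => /rowP/(_ 0)/eqP; rewrite !mxE eqxx oner_eq0.
  case=> // B uB ->; exists B => //; apply/rowP=> j.
  rewrite -rowE !mxE; congr (B _ _); exact/val_inj.
rewrite -[B]vsubmxK -defv in uB.
set V := dsubmx B in uB.
have [b def_b] : exists b, b = V *m Q *m v^T by eexists.
(* [E] clears the products [b] of the other rows with v, leaving the entry 1 and the block [D], to
   which induction applies. *)
pose E : 'M[C]_(1 + m) := block_mx 1%:M 0 (- b) 1%:M.
have uE : E \in unitmx by rewrite unitmxE det_lblock !det1 mulr1 unitr1.
pose D := V *m Q *m V^T - b *m b^T.
have sD : D^T = D by rewrite linearB /= !trmx_mul !trmxK sQ mulmxA.
have [P uP [r le_r defD]] := IHm D sD.
pose F : 'M[C]_(1 + m) := block_mx 1%:M 0 0 P.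
have uF : F \in unitmx by rewrite unitmxE det_lblock !det1 mul1r -unitmxE.
exists (F *m E *m col_mx v V); first by rewrite !unitmx_mul uF uE.
exists r.+1 => //.
have vQv : v *m Q *m v^T = 1%:M by rewrite bil_mulr Qv.
have vQV : v *m Q *m V^T = b^T by rewrite def_b !trmx_mul trmxK sQ mulmxA.
have EBE : E *m col_mx v V *m Q *m (E *m col_mx v V)^T = block_mx 1%:M 0 0 D.
  rewrite mul_block_col !mul1mx mul0mx addr0 tr_col_mx mul_col_mx mul_col_row.
  rewrite linearD /= trmx_mul linearN /= !mulmxDl !mulmxDr !mulNmx.
  rewrite !mulmxN !mulmxA -!(mulmxA b) ?(mulmxA v) !vQv !vQV mulmx1.
  rewrite -def_b !mul1mx !addNr; congr block_mx.
  by rewrite add0r addrC.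
have -> : F *m E *m col_mx v V *m Q *m (F *m E *m col_mx v V)^T
        = F *m block_mx 1%:M 0 0 D *m F^T.
  by rewrite -EBE -!mulmxA -trmx_mul !mulmxA !trmx_mul !mulmxA.
rewrite tr_block_mx !mulmx_block trmx1 !trmx0 !mul0mx !mulmx0 !mul1mx !mulmx1.
rewrite !addr0 !add0r mul0mx defD.
apply/(@matrixP _ (1 + m) (1 + m)) => i j; rewrite [LHS]mxE [RHS]mxE.
case: (splitP i) => i' di; rewrite mxE; case: (splitP j) => j' dj;
  by rewrite !mxE di dj ?ord1 ?add1n.
Qed.

Lemma outerZ m c (u : 'rV[C]_m) : (c *: u)^T *m (c *: u) = c ^+ 2 *: (u^T *m u).
Proof. by rewrite -scalemxAr [(c *: u)^T]linearZ /= -scalemxAl scalerA. Qed.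

(** A nonzero row u spans the row space, so A = D u; symmetry makes D proportional to u^T, and a
    square root absorbs the factor. *)
Lemma sym_rank_le1 m (A : 'M[C]_m) :
  A^T = A -> (\rank A <= 1)%N -> exists w : 'rV_m, A = w^T *m w.
Proof.
move=> sA rA; have [->|/matrix0Pn[i [j nzAij]]] := eqVneq A 0.
  by exists 0; rewrite mulmx0.
have /submxP[D defA] : (A <= row i A)%MS.
  rewrite -(geq_leqif (mxrank_leqif_sup (row_sub i A))) (leq_trans rA) //.
  rewrite lt0n mxrank_eq0; apply: contraNneq nzAij => /rowP/(_ j).
  by rewrite !mxE => ->.
have [u def_u] : exists u, u = row i A by eexists.
rewrite -def_u in defA; have u_j : u 0 j = A i j by rewrite def_u mxE.
have AE l1 l2 : A l1 l2 = D l1 0 * u 0 l2 by rewrite {1}defA mxE big_ord1.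
have eD : D = (D j 0 / u 0 j) *: u^T.
  apply/colP=> l; rewrite [RHS]mxE [u^T _ _]mxE mulrAC -AE.
  by rewrite -[in RHS]sA [A^T _ _]mxE AE mulfK // u_j.
exists (sqrtC (D j 0 / u 0 j) *: u).
by rewrite outerZ sqrtCK scalemxAl -eD.
Qed.

(** * Matrices with vanishing orthogonal minors *)

Definition rank1_mod m (Q A : 'M[C]_m) :=
  exists t, exists w : 'rV_m, A = t *: Q + w^T *m w.

Definition orthogonal_minors m (Q A : 'M[C]_m) := forall x y z w,
  bil Q x z = 0 -> bil Q x w = 0 -> bil Q y z = 0 -> bil Q y w = 0 ->
  bil A x z * bil A y w = bil A x w * bil A y z.

(** On the complement of x, the minors on x, z and x, w make A(x, x) A(z, w) - A(x, z) A(x, w)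
    vanish whenever Q(z, w) does, hence proportional to Q. The rows of [K] span this complement. *)
Lemma orthogonal_minors_perp m (Q A : 'M_m) x :
    A^T = A -> Q^T = Q -> orthogonal_minors Q A ->
    bil Q x x = 0 -> bil A x x != 0 ->
  exists t, forall y w, bil Q x y = 0 -> bil Q x w = 0 ->
    bil A x x * bil (A - t *: Q) y w = bil A x y * bil A x w.
Proof.
move=> sA sQ omA Qxx nzA; pose a := bil A x x.
pose K := kermx (Q *m x^T).
have KP y : bil Q x y = 0 -> exists u, y = u *m K.
  move=> Qxy; apply/submxP/sub_kermxP; rewrite mulmxA bil_mulr bilC // Qxy.
  by apply/matrixP=> i j; rewrite !mxE mul0rn.
have KQ u : bil Q x (u *m K) = 0.
  by rewrite bilC // /bil -mulmxA -(mulmxA u) mulmx_ker mulmx0 mxE.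
pose N := a *: A - (x *m A)^T *m (x *m A).
have bN y w : bil N y w = a * bil A y w - bil A x y * bil A x w.
  rewrite bil_mxB bil_mxZ bil_rank1; congr (_ - _ * _).
  by rewrite trmx_mul sA mulmxA -/(bil A y x) bilC.
have [|t defN] := @bil_proportional _ (K *m N *m K^T) (K *m Q *m K^T).
  move=> z w; rewrite !bil_congr bN => Qzw.
  rewrite /a omA // ?KQ //; first by rewrite (bilC (z *m K) x sA) mulrC subrr.
  by rewrite bilC // KQ.
exists (t / a) => y w /KP[u ->] /KP[v ->].
have := congr1 (fun M => bil M u v) defN.
rewrite /= bil_mxZ !bil_congr bN bil_mxB !bil_mxZ -/a => /eqP.
rewrite subr_eq => /eqP eN; rewrite mulrDr eN; field; exact: nzA.
Qed.

Lemma rank1_mod_rescale m (Q A : 'M_m) x t :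
    A^T = A -> bil A x x != 0 ->
    (forall y w, bil A x x * bil (A - t *: Q) y w = bil A x y * bil A x w) ->
  rank1_mod Q A.
Proof.
move=> sA nza eA; exists t, ((sqrtC (bil A x x))^-1 *: (x *m A)).
apply/eqP; rewrite addrC -subr_eq; apply/eqP; apply: bil_inj => y w.
rewrite outerZ exprVn sqrtCK bil_mxZ.
rewrite bil_rank1; apply: (mulfI nza); rewrite eA mulVKf //.
by rewrite trmx_mul sA mulmxA -/(bil A y x) (bilC _ _ sA).
Qed.

(** For x in the radical of Q the complement of x is the whole space. *)
Lemma rank1_mod_radical m (Q A : 'M_m) x :
    A^T = A -> Q^T = Q -> orthogonal_minors Q A ->
    (forall y, bil Q x y = 0) -> bil A x x != 0 ->
  rank1_mod Q A.
Proof.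
move=> sA sQ omA Qx nza.
have [t eA] := orthogonal_minors_perp sA sQ omA (Qx x) nza.
by apply: (rank1_mod_rescale (x := x) (t := t)) => // y w; apply: eA.
Qed.

(** All four entries of each minor sit at pairs where Q vanishes, so the minors see A only modulo
    Q. *)
Lemma orthogonal_minors_shift m (Q A : 'M_m) t :
  orthogonal_minors Q A -> orthogonal_minors Q (A - t *: Q).
Proof.
move=> omA x y z w Qxz Qxw Qyz Qyw; have := omA _ _ _ _ Qxz Qxw Qyz Qyw.
by rewrite !bil_mxB !bil_mxZ Qxz Qxw Qyz Qyw !mulr0 !subr0.
Qed.

(** Splitting off the hyperbolic plane of x and h lowers the rank by at most 2, so its complement
    still contains two orthonormal vectors. *)
Lemma hyperbolic_complement m (Q : 'M[C]_m) x :
    Q^T = Q -> (4 <= \rank Q)%N -> bil Q x x = 0 ->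
    (exists y, bil Q x y != 0) ->
  exists h e f, [/\ [/\ bil Q x h = 1, bil Q h h = 0, bil Q x e = 0 & bil Q x f = 0],
    bil Q h e = 0, bil Q h f = 0 & [/\ bil Q e f = 0, bil Q e e = 1 & bil Q f f = 1]].
Proof.
move=> sQ rQ Qxx [y nzQ]; have [h0 Qh0] : exists h0, bil Q x h0 = 1.
  by exists ((bil Q x y)^-1 *: y); rewrite bilZr mulVf.
have [h [Qh Qhh]] : exists h, bil Q x h = 1 /\ bil Q h h = 0.
  exists (h0 - (bil Q h0 h0 / 2%:R) *: x); rewrite !bil_lin Qxx (bilC h0 x sQ) Qh0.
  by split; [ring | field].
have Qhx : bil Q h x = 1 by rewrite bilC.
(* [p] is the orthogonal projection away from x and h, and [Q'] is Q composed with it. *)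
pose p z := z - bil Q z h *: x - bil Q z x *: h.
pose Q' := Q - (h *m Q)^T *m (x *m Q) - (x *m Q)^T *m (h *m Q).
have bQ' z w : bil Q' z w = bil Q z w - bil Q z h * bil Q x w - bil Q z x * bil Q h w.
  by rewrite !bil_mxB !bil_rank1 !trmx_mul sQ !mulmxA.
have sQ' : Q'^T = Q'.
  by rewrite /Q' !linearB /= !trmx_mul !trmxK sQ addrAC.
have Qp z w : bil Q (p z) (p w) = bil Q' z w.
  rewrite bQ' !bil_lin Qxx Qhh Qh Qhx (bilC x w sQ) (bilC h w sQ); ring.
have Qxp z : bil Q x (p z) = 0 by rewrite !bil_lin Qxx Qh (bilC x z sQ); ring.
have Qhp z : bil Q h (p z) = 0 by rewrite !bil_lin Qhh Qhx (bilC h z sQ); ring.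
have rQ' : (2 <= \rank Q')%N.
  have r1 (u v : 'rV[C]_m) : (\rank (u^T *m v) <= 1)%N.
    exact: leq_trans (mxrankM_maxr _ _) (rank_leq_row _).
  have defQ : Q = Q' + (h *m Q)^T *m (x *m Q) + (x *m Q)^T *m (h *m Q).
    by rewrite /Q' addrAC !subrK.
  rewrite -(leq_add2r 2) (leq_trans rQ) // [X in \rank X]defQ.
  rewrite (leq_trans (mxrank_add _ _)) // (addnA _ 1 1)%N leq_add //.
  by rewrite (leq_trans (mxrank_add _ _)) // leq_add.
have [P _ defP] := congr_pid_mx sQ'.
have bP i j : bil Q' (row i P) (row j P) = ((i == j) && (i < \rank Q')%N)%:R.
  by rewrite !rowE -bil_congr defP bil_delta mxE -val_eqE.
have m2 : (2 <= m)%N by apply: leq_trans rQ' (rank_leq_row _).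
pose i0 := Ordinal (ltnW m2); pose i1 := Ordinal m2.
exists h, (p (row i0 P)), (p (row i1 P)).
by rewrite !Qxp !Qhp !Qp !bP /= rQ' (ltnW rQ').
Qed.

(* Write a A = A(x, .) A(., x) + R, where R vanishes on the complement of x.  The
   minors on x, h +- y and x +- u, w give (a +- A(x, u)) R(h, w) = +- A(x, w) R(h, u),
   hence R(h, w) = 0; then those on x +- e, h -+ e and x +- f, h -+ f give
   R(h, h) = 0. *)
Lemma orthogonal_minors_extend m (Q A : 'M[C]_m) x h e f :
    A^T = A -> Q^T = Q -> orthogonal_minors Q A ->
    bil Q x x = 0 -> bil A x x != 0 ->
    (forall y w, bil Q x y = 0 -> bil Q x w = 0 ->
       bil A x x * bil A y w = bil A x y * bil A x w) ->
    [/\ bil Q x h = 1, bil Q h h = 0, bil Q x e = 0 & bil Q x f = 0] ->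
    bil Q h e = 0 -> bil Q h f = 0 ->
    [/\ bil Q e f = 0, bil Q e e = 1 & bil Q f f = 1] ->
  forall y w, bil A x x * bil A y w = bil A x y * bil A x w.
Proof.
move=> sA sQ omA Qxx nza perpA [Qxh Qhh Qxe Qxf] Qhe Qhf [Qef Qee Qff].
have a2 : 2%:R * bil A x x != 0 by rewrite mulf_neq0 ?pnatr_eq0.
have QC u v : bil Q u v = bil Q v u by apply: bilC.
have AC u v : bil A u v = bil A v u by apply: bilC.
pose R y w := bil A x x * bil A y w - bil A x y * bil A x w.
have RE y w : bil A x x * bil A y w = bil A x y * bil A x w + R y w.
  by rewrite /R addrC subrK.
have R0 y w : bil Q x y = 0 -> bil Q x w = 0 -> R y w = 0.
  by move=> ? ?; rewrite /R perpA // subrr.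
have RhH w : bil Q x w = 0 -> bil Q h w = 0 -> R h w = 0.
  move=> Qxw Qhw.
  (* In the plane of e and f, take y orthogonal to w and u with Q(y, u) = -1; then Q(h + c y, x + c
     u) = 1 - c^2, which is zero for both signs. *)
  have [y [u [[Qxy Qhy Qxu Qhu] Qyw Qyu]]] : exists y u,
      [/\ [/\ bil Q x y = 0, bil Q h y = 0, bil Q x u = 0 & bil Q h u = 0],
         bil Q y w = 0 & bil Q y u = -1].
    have [Qfw|nzf] := eqVneq (bil Q f w) 0.
      by exists f, (- f); rewrite !bil_lin Qxf Qhf Qff Qfw oppr0.
    exists (bil Q f w *: e - bil Q e w *: f), (- (bil Q f w)^-1 *: e).
    rewrite !bil_lin Qxe Qxf Qhe Qhf Qee (QC f e) Qef !mulr0 !subr0.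
    by split=> //; [ring | field].
  have key c : c ^+ 2 = 1 -> (bil A x x + c * bil A x u) * R h w
                             = c * bil A x w * R h u.
    move=> c1.
    have Q1 : bil Q x (x + c *: u) = 0 by rewrite !bil_lin Qxx Qxu mulr0 addr0.
    have Q2 : bil Q (h + c *: y) (x + c *: u) = 0.
      rewrite !bil_lin (QC h x) Qxh Qhu (QC y x) Qxy Qyu.
      by rewrite !(mulr0, addr0, add0r) mulrN1 mulrN -expr2 c1 subrr.
    have Q3 : bil Q (h + c *: y) w = 0 by rewrite !bil_lin Qhw Qyw mulr0 addr0.
    have /(congr1 (fun v => bil A x x * v)) := omA _ _ _ _ Q1 Qxw Q2 Q3.
    rewrite !bil_lin (AC h x) (AC y x) => /eqP; rewrite -subr_eq0 => /eqP e1.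
    have e4 := perpA y w Qxy Qxw.
    have e5 := perpA y u Qxy Qxu.
    by apply: subr0_eq; rewrite -[RHS]e1 /R; ring: e4 e5.
  have k1 := key 1 (expr1n _ _); have k2 := key (-1).
  have {}k2 := k2 (etrans (sqrrN 1) (expr1n _ _)).
  (* Adding the instances c = 1 and c = -1 cancels A(x, u) on the left and everything on the
     right. *)
  apply: (mulfI a2); rewrite mulr0; transitivity
    ((bil A x x + 1 * bil A x u) * R h w + (bil A x x + -1 * bil A x u) * R h w).
    by ring.
  by rewrite k1 k2; ring.
have RC y w : R y w = R w y by rewrite /R (AC y w) [X in _ - X]mulrC.
have Rl c y y' w : R (y + c *: y') w = R y w + c * R y' w.
  rewrite /R !bil_lin; ring.
have Rx w : R x w = 0 by rewrite /R subrr.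
have RhP w : bil Q x w = 0 -> R h w = 0.
  (* Removing the multiple Q(h, w) x makes w orthogonal to h too, and R vanishes on x. *)
  move=> Qxw; have -> : w = w - bil Q h w *: x + bil Q h w *: x by rewrite subrK.
  rewrite RC Rl Rx mulr0 addr0 RC RhH // !bil_lin ?Qxx ?Qxw; first ring.
  by rewrite (QC h x) Qxh; ring.
have Rhh : R h h = 0.
  have key s t : s ^+ 2 = 1 -> t ^+ 2 = 1 ->
      (bil A x x + s * bil A x e) * (bil A x x + t * bil A x f) * R h h = 0.
    move=> s1 t1.
    have Q1 : bil Q (x + s *: e) (x + t *: f) = 0.
      by rewrite !bil_lin Qxx Qxf (QC e x) Qxe Qef; ring.
    have Q2 : bil Q (x + s *: e) (h - s *: e) = 0.
      by rewrite !bil_lin Qxh Qxe (QC e h) Qhe Qee; ring: s1.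
    have Q3 : bil Q (h - t *: f) (x + t *: f) = 0.
      by rewrite !bil_lin (QC h x) Qxh (QC f x) Qxf Qhf Qff; ring: t1.
    have Q4 : bil Q (h - t *: f) (h - s *: e) = 0.
      by rewrite !bil_lin Qhh Qhe (QC f h) Qhf (QC f e) Qef; ring.
    have Rr c y w w' : R y (w + c *: w') = R y w + c * R y w'.
      by rewrite !(RC y) Rl.
    have Ref : [/\ R e f = 0, R e e = 0 & R f f = 0] by rewrite !R0.
    have Rhef : R h e = 0 /\ R h f = 0 by rewrite !RhP.
    case: Ref Rhef => Ref Ree Rff [Rhe Rhf].
    have Ryz : R (x + s *: e) (x + t *: f) = 0.
      by rewrite Rl Rx Rr RC Rx Ref; ring.
    have Ryz' : R (x + s *: e) (h - s *: e) = 0.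
      by rewrite -scaleNr Rl Rx Rr RC Rhe Ree; ring.
    have Ry'z : R (h - t *: f) (x + t *: f) = 0.
      by rewrite -scaleNr Rl !Rr RC Rx (RC f) Rx Rhf Rff; ring.
    have Ry'z' : R (h - t *: f) (h - s *: e) = R h h.
      by rewrite -!scaleNr Rl !Rr (RC f h) (RC f e) Rhe Rhf Ref; ring.
    have := omA _ _ _ _ Q1 Q2 Q3 Q4.
    move=> /(congr1 (fun v => bil A x x * bil A x x * v)).
    rewrite mulrACA [X in _ = X]mulrACA !RE Ryz Ryz' Ry'z Ry'z' => /eqP.
    rewrite -subr_eq0 => /eqP e1.
    by rewrite -[RHS]e1 !bil_lin; ring.
  have m1 : (-1) ^+ 2 = 1 :> C by rewrite sqrrN expr1n.
  have p1 : 1 ^+ 2 = 1 :> C by rewrite expr1n.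
  (* The sum over the four choices of signs is 4 A(x, x)^2 R(h, h). *)
  apply: (mulfI a2); apply: (mulfI a2); rewrite !mulr0.
  transitivity ((bil A x x + 1 * bil A x e) * (bil A x x + 1 * bil A x f) * R h h
    + (bil A x x + 1 * bil A x e) * (bil A x x + -1 * bil A x f) * R h h
    + (bil A x x + -1 * bil A x e) * (bil A x x + 1 * bil A x f) * R h h
    + (bil A x x + -1 * bil A x e) * (bil A x x + -1 * bil A x f) * R h h).
    by ring.
  by rewrite !key // !addr0.
have RhA w : R h w = 0.
  have -> : w = w - bil Q x w *: h + bil Q x w *: h by rewrite subrK.
  rewrite RC Rl Rhh mulr0 addr0 RC RhP // !bil_lin Qxh; ring.
move=> y w; apply/eqP; rewrite -subr_eq0; apply/eqP; rewrite -/(R y w).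
have -> : y = y - bil Q x y *: h + bil Q x y *: h by rewrite subrK.
have -> : w = w - bil Q x w *: h + bil Q x w *: h by rewrite subrK.
rewrite Rl RhA mulr0 addr0 RC Rl RhA mulr0 addr0 R0 // !bil_lin Qxh; ring.
Qed.

Lemma bil_delta_pid m s i j :
  bil (pid_mx s : 'M[C]_m) (delta_mx 0 i) (delta_mx 0 j)
    = ((i == j) && (i < s)%N)%:R.
Proof. by rewrite bil_delta mxE -val_eqE. Qed.

Lemma exists_lt_neq m s (j : 'I_m) :
  (1 < s)%N -> (s <= m)%N -> exists2 l : 'I_m, (l < s)%N & j != l.
Proof.
move=> s2 sm; have m1 : (1 < m)%N by apply: leq_trans s2 sm.
have [j0|j0] := eqVneq (val j) 0%N.
  by exists (Ordinal m1) => //; rewrite -val_eqE j0.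
by exists (Ordinal (ltnW m1)); rewrite ?(ltnW s2) // -val_eqE.
Qed.

(* The isotropic vectors e_i +- 'i e_j, e_d and e_d + e_i +- 'i e_j suffice. *)
Lemma isotropic_proportional m s (A : 'M[C]_m) :
    (2 <= s)%N -> (s <= m)%N -> A^T = A ->
    (forall x, bil (pid_mx s) x x = 0 -> bil A x x = 0) ->
  exists t, A = t *: pid_mx s.
Proof.
move=> s2 sm sA isoA.
have AC i j : A i j = A j i by rewrite -[in LHS]sA mxE.
have iso2 (i j : 'I_m) : i != j -> (i < s)%N -> (j < s)%N -> A i i = A j j /\ A i j = 0.
  move=> ij si sj.
  have key c : c ^+ 2 = -1 -> A i i - A j j + 2%:R * c * A i j = 0.
    move=> c1; have := isoA (delta_mx 0 i + c *: delta_mx 0 j).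
    rewrite !bil_lin !bil_delta_pid !bil_delta !eqxx (eq_sym j i).
    rewrite (negPf ij) si sj (AC j i) /= => <-; ring: c1.
  have k1 := key 'i (sqrCi _).
  have k2 := key (- 'i) (etrans (sqrrN _) (sqrCi _)).
  split.
    apply: subr0_eq; apply: (mulfI (_ : 2%:R != 0)); first by rewrite pnatr_eq0.
    by rewrite mulr0 -[RHS](addr0 0) -{1}k1 -k2; ring.
  apply: (mulfI (_ : 4%:R * 'i != 0)); first by rewrite mulf_neq0 ?pnatr_eq0 ?neq0Ci.
  by rewrite mulr0 -[RHS](subrr 0) -{1}k1 -k2; ring.
have rad (d : 'I_m) : (s <= d)%N -> forall j, A d j = 0.
  move=> sd j; have sdF : (d < s)%N = false by rewrite ltnNge sd.
  have Add : A d d = 0.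
    by have := isoA (delta_mx 0 d); rewrite bil_delta_pid bil_delta sdF andbF => ->.
  have [->//|jd] := eqVneq j d; have dj : d == j = false by rewrite eq_sym (negPf jd).
  have two0 (v : C) : 2%:R * v = 0 -> v = 0.
    by move/eqP; rewrite mulf_eq0 pnatr_eq0 => /eqP.
  have [sj|js] := leqP s j.
    have sjF : (j < s)%N = false by rewrite ltnNge sj.
    have Ajj : A j j = 0.
      by have := isoA (delta_mx 0 j); rewrite bil_delta_pid bil_delta sjF andbF => ->.
    apply: two0; have := isoA (delta_mx 0 d + delta_mx 0 j).
    rewrite !bil_lin !bil_delta_pid !bil_delta sdF sjF !andbF !addr0 => /(_ erefl).
    by rewrite Add Ajj (AC j d) addr0 add0r mulr_natl mulr2n.
  have [l ls lj] := exists_lt_neq j s2 sm.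
  have [ejl ajl] := iso2 _ _ lj js ls.
  have dl : d == l = false by apply/negbTE; apply: contraTneq ls => <-; rewrite sdF.
  have key c : c ^+ 2 = -1 -> A d j + c * A d l = 0.
    move=> c1; apply: two0.
    have := isoA (delta_mx 0 d + (delta_mx 0 j + c *: delta_mx 0 l)).
    rewrite !bil_lin !bil_delta_pid !bil_delta !eqxx sdF js ls /=.
    rewrite dj dl (eq_sym j d) dj (eq_sym l d) dl (eq_sym l j) (negPf lj) /=.
    rewrite (AC j d) (AC l d) (AC l j) ajl Add -ejl => <-; first by ring: c1.
    by ring: c1.
  have k1 := key 'i (sqrCi _).
  have k2 := key (- 'i) (etrans (sqrrN _) (sqrCi _)).
  by apply: two0; rewrite -[RHS](addr0 0) -{1}k1 -k2; ring.
have m0 : (0 < m)%N by apply: leq_trans sm; apply: ltnW.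
exists (A (Ordinal m0) (Ordinal m0)); apply/matrixP=> i j; rewrite !mxE.
have [si|si] := leqP s i; first by rewrite rad // andbF mulr0.
have [sj|sj] := leqP s j.
  rewrite AC rad //; case: eqP => [ij|]; last by rewrite mulr0.
  by rewrite ij ltnNge sj in si.
rewrite val_eqE andbT; have [->|ij] := eqVneq i j; last first.
  by rewrite mulr0; case: (iso2 i j).
rewrite mulr1; have [->//|nj] := eqVneq j (Ordinal m0).
by case: (iso2 j (Ordinal m0)) => //=; apply: ltnW.
Qed.

(** Three cases: A vanishes on all isotropic vectors; some isotropic x with A(x, x) nonzero is in
    the radical; or such an x lies in a hyperbolic plane, whose complement has rank at least 2. *)
Lemma orthogonal_minors_rank1 m s (A : 'M[C]_m) :
    (4 <= s)%N -> (s <= m)%N -> A^T = A -> orthogonal_minors (pid_mx s) A ->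
  rank1_mod (pid_mx s) A.
Proof.
move=> s4 sm sA omA; set Q : 'M_m := pid_mx s.
have sQ : Q^T = Q by rewrite tr_pid_mx.
have [[x [Qxx nza]]|noiso] :=
  boolp.EM (exists x, bil Q x x = 0 /\ bil A x x != 0); last first.
  have [||||t ->] := @isotropic_proportional m s A; rewrite ?(leq_trans _ s4) //.
    move=> x Qxx; apply/eqP/negP => nza; apply: noiso; exists x; split=> //.
    exact/negP.
  by exists t, 0; rewrite mulmx0 addr0.
have [[y nzQ]|rad] := boolp.EM (exists y, bil Q x y != 0); last first.
  apply: (rank1_mod_radical sA sQ omA _ nza) => y.
  by apply/eqP/negP => /negP nzQ; apply: rad; exists y.
have rQ : (4 <= \rank Q)%N by rewrite rank_pid_mx.
have [h [e [f [[Qxh Qhh Qxe Qxf] Qhe Qhf [Qef Qee Qff]]]]] :=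
  hyperbolic_complement sQ rQ Qxx (ex_intro _ y nzQ).
have [t eA] := orthogonal_minors_perp sA sQ omA Qxx nza.
have sA' : (A - t *: Q)^T = A - t *: Q by rewrite linearB linearZ /= sA sQ.
have bx z : bil Q x z = 0 -> bil (A - t *: Q) x z = bil A x z.
  by move=> Qz; rewrite bil_mxB bil_mxZ Qz mulr0 subr0.
(* Replacing A by A - t Q makes the rank one identity exact on the complement of x, from where it
   extends to all vectors. *)
have [u [w eA']] : rank1_mod Q (A - t *: Q).
  apply: (rank1_mod_rescale (x := x) (t := 0)) => //; first by rewrite bx.
  move=> y' w; rewrite scale0r subr0.
  apply: (@orthogonal_minors_extend m Q (A - t *: Q) x h e f) => //.
  - exact: orthogonal_minors_shift.
  - by rewrite bx.
  - by move=> z v Qz Qv; rewrite !bx //; apply: eA.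
by exists (t + u), w; rewrite scalerDl -addrA -eA' addrC subrK.
Qed.

(* If A(d, d) = 0 for every radical d, the minors on d and an isotropic y give
   A(d, y) ^ 2 = 0, so that A is supported on its leading s x s block. *)
Lemma orthogonal_minors_block m s (A : 'M[C]_m) (G := pid_mx s : 'M[C]_(s, m)) :
    (2 <= s)%N -> (s <= m)%N -> A^T = A -> orthogonal_minors (pid_mx s) A ->
    (exists t, exists w : 'rV_s, G *m A *m G^T = t%:M + w^T *m w) ->
  rank1_mod (pid_mx s) A.
Proof.
move=> s2 sm sA omA [t [w eA']]; set Q : 'M_m := pid_mx s.
have sQ : Q^T = Q by rewrite tr_pid_mx.
have GG : G^T *m G = Q by rewrite tr_pid_mx mul_pid_mx !minnn.
have AC i j : A i j = A j i by rewrite -[in LHS]sA mxE.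
have Qd (d : 'I_m) y : (s <= d)%N -> bil Q (delta_mx 0 d) y = 0.
  move=> sd; rewrite /bil -rowE (_ : row d Q = 0) ?mul0mx ?mxE //.
  by apply/rowP => j; rewrite !mxE ltnNge sd andbF.
case: (pickP (fun d : 'I_m => (s <= d)%N && (A d d != 0))) => [d /andP[sd nzd]|A0].
  by apply: (rank1_mod_radical sA sQ omA (x := delta_mx 0 d)) => [y|];
    rewrite ?bil_delta ?Qd.
have iso0 (d : 'I_m) y : (s <= d)%N -> bil Q y y = 0 -> bil A (delta_mx 0 d) y = 0.
  move=> sd Qy; have QC : bil Q y (delta_mx 0 d) = 0 by rewrite bilC // Qd.
  have := omA (delta_mx 0 d) y (delta_mx 0 d) y (Qd _ _ sd) (Qd _ _ sd) QC Qy.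
  rewrite bil_delta; have /negbFE/eqP -> : A d d != 0 = false.
    by have := A0 d; rewrite sd.
  by rewrite mul0r (bilC y _ sA) => /esym/eqP; rewrite mulf_eq0 orbb => /eqP.
have rad (d : 'I_m) : (s <= d)%N -> forall j, A d j = 0.
  move=> sd j; have [sj|js] := leqP s j.
    by rewrite -bil_delta iso0 // Qd.
  have [l ls lj] := exists_lt_neq j s2 sm.
  have key c : c ^+ 2 = -1 -> A d j + c * A d l = 0.
    move=> c1; have := iso0 d (delta_mx 0 j + c *: delta_mx 0 l) sd.
    rewrite !bil_lin !bil_delta_pid !bil_delta !eqxx js ls.
    rewrite (eq_sym l j) (negPf lj) /= => -> //; ring: c1.
  have k1 := key 'i (sqrCi _).
  have k2 := key (- 'i) (etrans (sqrrN _) (sqrCi _)).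
  apply: (mulfI (_ : 2%:R != 0)); first by rewrite pnatr_eq0.
  by rewrite mulr0 -[RHS](addr0 0) -{1}k1 -k2; ring.
(* [Q] projects onto the first s coordinates, so A is G^T (G A G^T) G, while G^T G = Q turns the
   scalar t of the block into t Q. *)
have QA : Q *m A = A.
  apply/matrixP => i j; rewrite mxE; have [si|si] := leqP s i.
    by rewrite rad // big1 // => l _; rewrite mxE ltnNge si andbF mul0r.
  rewrite (bigD1 i) //= big1 => [|l li]; rewrite !mxE ?eqxx ?si ?mul1r ?addr0 //.
  by rewrite val_eqE eq_sym (negPf li) mul0r.
have AQ : A *m Q = A by rewrite -{1}sA -sQ -trmx_mul QA sA.
exists t, (w *m G); rewrite -{1}AQ -{1}QA -GG.
transitivity (G^T *m (G *m A *m G^T) *m G); first by rewrite !mulmxA.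
by rewrite eA' mulmxDr mulmxDl mul_mx_scalar -scalemxAl trmx_mul !mulmxA.
Qed.
End Bilinear.

(** * Blocks of size two and three *)

(* [p, q, x, z, w] are the coordinates [b00 - b22, b11 - b22, b01, b02, b12] of
   a symmetric 3x3 matrix B modulo the identity, and [P, Q, X, Z, W] those of
   (B - b22)^2; the cubics are 2x2 minors of these two vectors.  Only seven of
   the ten are needed, as B commutes with B^2. *)
Definition cubic_minors (R : pzRingType) (p q x z w : R) : seq R :=
  let P := p * p + x * x - w * w in let Q := q * q + x * x - z * z in
  let X := p * x + x * q + z * w in let Z := p * z + x * w in
  let W := x * z + q * w in
  [:: x * P - p * X; x * Q - q * X; z * P - p * Z; z * Q - q * Z;
      w * P - p * W; w * Q - q * W; p * Q - q * P].

Lemma map_cubic_minors (R S : pzRingType) (f : {rmorphism R -> S}) p q x z w :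
  map f (cubic_minors p q x z w) = cubic_minors (f p) (f q) (f x) (f z) (f w).
Proof. by rewrite /cubic_minors /= !(rmorphB, rmorphD, rmorphM). Qed.

Section SmallBlocks.
Variable C : numClosedFieldType.

Lemma sym2_rank1_mod (B : 'M[C]_2) :
  B^T = B -> exists t, exists w : 'rV_2, B = t%:M + w^T *m w.
Proof.
move=> sB; have [t] : exists t, eigenvalue B t.
  have /closed_rootP[t rt] : size (char_poly B) != 1 by rewrite size_char_poly.
  by exists t; rewrite eigenvalue_root_char.
move=> /eigenvalueP[v vB nzv].
have sBt : (B - t%:M)^T = B - t%:M by rewrite linearB /= tr_scalar_mx sB.
have [|w eB] := sym_rank_le1 sBt; last by exists t, w; rewrite -eB addrC subrK.
rewrite -ltnS ltn_neqAle rank_leq_row andbT; apply: contra nzv => fB.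
rewrite -(mulmx_free_eq0 _ fB) mulmxBr vB mul_mx_scalar subrr; exact: eqxx.
Qed.

Lemma ord3P (i : 'I_3) : [\/ i = 0, i = 1 | i = 2].
Proof.
by case: i => [[|[|[]]]] // ?; [constructor 1|constructor 2|constructor 3];
  apply/val_inj.
Qed.

(** The minors make D^2 a combination al D + (z^2 + w^2) of D and the identity, where D = B - b22;
    this quadratic equation factors. *)
Lemma cubic_minors_rank1_mod (B : 'M[C]_3) :
    B^T = B ->
    {in cubic_minors (B 0 0 - B 2 2) (B 1 1 - B 2 2) (B 0 1) (B 0 2) (B 1 2),
       forall c, c = 0} ->
  exists t, exists w : 'rV_3, B = t%:M + w^T *m w.
Proof.
move=> sB; have BC i j : B i j = B j i by rewrite -[in LHS]sB mxE.
pose D := B - (B 2 2)%:M.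
have sD : D^T = D by rewrite linearB /= tr_scalar_mx sB.
rewrite /cubic_minors; set p := B 0 0 - B 2 2; set q := B 1 1 - B 2 2.
set x := B 0 1; set z := B 0 2; set w := B 1 2.
set P := p * p + _ - _; set Q := q * q + _ - _; set X := p * x + _ + _.
set Z := p * z + _; set W := x * z + _ => c0.
have in7 c : c \in [:: x * P - p * X; x * Q - q * X; z * P - p * Z; z * Q - q * Z;
    w * P - p * W; w * Q - q * W; p * Q - q * P] -> c = 0 := c0 c.
have k1 : x * P = p * X by apply/subr0_eq/in7; rewrite !inE eqxx ?orbT.
have k2 : x * Q = q * X by apply/subr0_eq/in7; rewrite !inE eqxx ?orbT.
have k3 : z * P = p * Z by apply/subr0_eq/in7; rewrite !inE eqxx ?orbT.
have k4 : z * Q = q * Z by apply/subr0_eq/in7; rewrite !inE eqxx ?orbT.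
have k5 : w * P = p * W by apply/subr0_eq/in7; rewrite !inE eqxx ?orbT.
have k6 : w * Q = q * W by apply/subr0_eq/in7; rewrite !inE eqxx ?orbT.
have k7 : p * Q = q * P by apply/subr0_eq/in7; rewrite !inE eqxx ?orbT.
(* As polynomials, the three missing minors are the sixth cubic, the third cubic, and the difference
   of the first two. *)
have k8 : x * Z = z * X.
  by apply: subr0_eq; rewrite -[RHS](subrr (w * Q)) {2}k6 /X /Z /Q /W; ring.
have k9 : x * W = w * X.
  by apply: subr0_eq; rewrite -[RHS](subrr (z * P)) {2}k3 /X /Z /P /W; ring.
have k10 : z * W = w * Z.
  apply: subr0_eq; transitivity ((x * P - p * X) - (x * Q - q * X)).
    by rewrite /X /Z /P /Q /W; ring.
  by rewrite k1 k2 !subrr.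
have [v0|nzv] := boolP [&& p == 0, q == 0, x == 0, z == 0 & w == 0].
  case/and5P: v0 => /eqP p0 /eqP q0 /eqP x0 /eqP z0 /eqP w0.
  have [B10 B20 B21] : [/\ B 1 0 = 0, B 2 0 = 0 & B 2 1 = 0].
    by rewrite (BC 1 0) (BC 2 0) (BC 2 1).
  exists (B 2 2), 0; rewrite mulmx0 addr0; apply/matrixP => i j; rewrite mxE.
  case: (ord3P i) => ->; case: (ord3P j) => -> //=; exact: subr0_eq.
(* Some coordinate of D modulo the identity is nonzero, and the ratio there is the common factor
   [al]. *)
have [al [eP eQ eX eZ eW]] : exists al,
    [/\ P = al * p, Q = al * q, X = al * x, Z = al * z & W = al * w].
  have prop (a b a' b' : C) : a != 0 -> a * b' = b * a' -> b' = a' / a * b.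
    by move=> nza e; apply: (mulfI nza); rewrite e; field.
  move: nzv; rewrite !negb_and => /or4P[nz|nz|nz|/orP[nz|nz]];
    [exists (P / p)|exists (Q / q)|exists (X / x)|exists (Z / z)|exists (W / w)];
    split; apply: prop => //.
(* The roots r and al - r have product -(z^2 + w^2), where z^2 + w^2 is the last diagonal entry of
   D^2, since D 2 2 = 0. *)
have [r er] : exists r, r ^+ 2 = al * r + (z * z + w * w).
  exists ((al + sqrtC (al ^+ 2 + 4%:R * (z * z + w * w))) / 2%:R).
  have := sqrtCK (al ^+ 2 + 4%:R * (z * z + w * w)).
  by move: (sqrtC _) => r r2; field: r2.
have Dr : (D - r%:M) *m (D - (al - r)%:M) = 0.
  have D22 : D 2 2 = 0 by rewrite !mxE subrr.
  have [D00 D11] : D 0 0 = p /\ D 1 1 = q by rewrite !mxE.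
  have D01 : D 0 1 = x by rewrite !mxE mulr0n subr0.
  have D02 : D 0 2 = z by rewrite !mxE mulr0n subr0.
  have D12 : D 1 2 = w by rewrite !mxE mulr0n subr0.
  have D10 : D 1 0 = x by rewrite -sD mxE.
  have D20 : D 2 0 = z by rewrite -sD mxE.
  have D21 : D 2 1 = w by rewrite -sD mxE.
  have mulE (M N : 'M[C]_3) i j :
      (M *m N) i j = M i 0 * N 0 j + M i 1 * N 1 j + M i 2 * N 2 j.
    rewrite mxE !big_ord_recl big_ord0 addr0 addrA.
    by congr (_ + _ * _ + _ * _); congr fun_of_matrix; apply/val_inj.
  have subE c i j : (D - c%:M) i j = D i j - c *+ (i == j) by rewrite !mxE.
  have zr : al * r + (z * z + w * w) - r ^+ 2 = 0 by rewrite er subrr.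
  have [zP zQ] : P - al * p = 0 /\ Q - al * q = 0 by rewrite eP eQ !subrr.
  have [zX zZ zW] : [/\ X - al * x = 0, Z - al * z = 0 & W - al * w = 0].
    by rewrite eX eZ eW !subrr.
  apply/matrixP => i j; rewrite mulE [RHS]mxE !subE.
  case: (ord3P i) => ->; case: (ord3P j) => ->;
    rewrite /= ?(D00, D01, D02, D10, D11, D12, D20, D21, D22).
  - by rewrite -[RHS](addr0 0) -{1}zP -zr /P; ring.
  - by rewrite -[RHS]zX /X; ring.
  - by rewrite -[RHS]zZ /Z; ring.
  - by rewrite -[RHS]zX /X; ring.
  - by rewrite -[RHS](addr0 0) -{1}zQ -zr /Q; ring.
  - by rewrite -[RHS]zW /W; ring.
  - by rewrite -[RHS]zZ /Z; ring.
  - by rewrite -[RHS]zW /W; ring.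
  - by rewrite -[RHS]zr; ring.
have small (c : C) : (\rank (D - c%:M)%R <= 1)%N ->
    exists t, exists w : 'rV_3, B = t%:M + w^T *m w.
  have sDc : (D - c%:M)^T = D - c%:M by rewrite linearB /= tr_scalar_mx sD.
  case/(sym_rank_le1 sDc) => u eu; exists (B 2 2 + c), u.
  by rewrite -eu /D raddfD /= addrACA subrr addr0 addrC subrK.
(* By Sylvester's inequality, two 3x3 matrices with product zero have ranks adding up to at most
   3. *)
have [|big] := leqP (\rank (D - r%:M)) 1; first exact: small.
apply: (small (al - r)); have := mxrank_mul_min (D - r%:M) (D - (al - r)%:M).
rewrite Dr mxrank0 leqn0 subn_eq0 => le3; rewrite -(leq_add2l 2).
by apply: leq_trans le3; rewrite leq_add2r.
Qed.
End SmallBlocks.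

(** * Spaces of homogeneous polynomials *)

Section Homogeneous.
Variable C : fieldType.

Lemma comp_mpoly_homog n k (lq : n.-tuple {mpoly C[k]}) d e (p : {mpoly C[n]}) :
    p \is d.-homog -> (forall i, tnth lq i \is e.-homog) ->
  p \mPo lq \is (d * e).-homog.
Proof.
move=> /dhomogP hp hq; rewrite comp_mpolyEX big_seq; apply: rpred_sum => u up.
apply: rpredZ; have <- : mdeg u = d := hp u up.
rewrite comp_mpolyX mdegE big_distrl /=.
apply: (big_ind2 (fun (a : {mpoly C[k]}) b => a \is b.-homog)).
- exact: dhomog1.
- by move=> ? ? ? ?; apply: dhomogM.
- by move=> i _; rewrite mulnC; apply: dhomogMn.
Qed.

(** [indhomog] takes a default value at polynomials that are not homogeneous of degree d, so
    homogeneity has to be supplied to read it back. *)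
Lemma indhomogK n d (p : {mpoly C[n]}) :
  p \is d.-homog -> val (indhomog d p) = p.
Proof. by move=> hp; rewrite /indhomog val_insubd hp. Qed.

Lemma indhomog_linear (aT : lmodType C) n d (f : {linear aT -> {mpoly C[n]}}) :
  (forall u, f u \is d.-homog) -> linear (fun u => indhomog d (f u) : dhomog n C d).
Proof.
by move=> hf a u v; apply/val_inj; rewrite indhomogK //= !indhomogK // linearP.
Qed.

Lemma dim_dhomog n d : \dim {:dhomog n.+1 C d} = 'C(d + n, d).
Proof. by rewrite dimvf. Qed.

Lemma mnm_cons n (m : 'X_{1..n}) d :
  mdeg m = d.+1 -> exists a, exists2 m', m = (U_(a) + m')%MM & mdeg m' = d.
Proof.
move=> dm; case: (pickP (fun a => m a != 0%N)) => [a ma|m0]; last first.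
  move: dm; rewrite mdegE big1 // => a _; exact/eqP/negbFE/m0.
exists a, (m - U_(a))%MM.
  by rewrite addmC submK //; rewrite lep1mP.
apply: succn_inj; rewrite -dm -[in RHS](@submK _ U_(a) m) ?lep1mP //.
by rewrite mdegD mdeg1 addn1.
Qed.

(** Membership stated for the underlying polynomial, so that identities can be computed in the full
    polynomial ring. *)
Definition vhomog n d (U : {vspace dhomog n.+1 C d}) (p : {mpoly C[n.+1]}) :=
  exists2 u, u \in U & val u = p.

Lemma vhomogD n d (U : {vspace dhomog n.+1 C d}) p q :
  vhomog U p -> vhomog U q -> vhomog U (p + q).
Proof. by move=> [u uU <-] [v vU <-]; exists (u + v) => //; apply: rpredD. Qed.

Lemma vhomogZ n d (U : {vspace dhomog n.+1 C d}) c p :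
  vhomog U p -> vhomog U (c *: p).
Proof. by move=> [u uU <-]; exists (c *: u) => //; apply: rpredZ. Qed.

Lemma vhomogB n d (U : {vspace dhomog n.+1 C d}) p q :
  vhomog U p -> vhomog U q -> vhomog U (p - q).
Proof. by move=> [u uU <-] [v vU <-]; exists (u - v) => //; apply: rpredB. Qed.

Lemma vhomogS n d (U W : {vspace dhomog n.+1 C d}) p :
  (U <= W)%VS -> vhomog U p -> vhomog W p.
Proof. by move=> /subvP sUW [u uU <-]; exists u => //; apply: sUW. Qed.

Lemma vhomog_full n d (U : {vspace dhomog n.+1 C d}) :
  (forall m, mdeg m = d -> vhomog U 'X_[m]) -> U = fullv.
Proof.
move=> monU; apply/eqP; rewrite eqEsubv subvf /=; apply/subvP=> p _.
have hp := dhomog_is_dhomog p.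
have [u uU eu] : vhomog U (val p).
  rewrite (mpolyE (val p)) big_seq; apply: (big_ind (vhomog U)).
  - by exists 0 => //; apply: rpred0.
  - exact: vhomogD.
  - by move=> m mp; apply/vhomogZ/monU; move/dhomogP: hp; apply.
by rewrite -(val_inj eu).
Qed.
End Homogeneous.

(** * Linear and quadratic forms as polynomials *)

Section QuadraticForms.
Variable C : numClosedFieldType.

(** Serves both for the forms ell_i on W and for linear equations in the coordinates of P^n. *)
Definition lin_mpoly m (x : 'rV[C]_m) : {mpoly C[m]} := \sum_a x 0 a *: 'X_a.

Lemma lin_mpoly_linear m : linear (@lin_mpoly m).
Proof.
move=> c x y; rewrite /lin_mpoly scaler_sumr -big_split; apply: eq_bigr => a _.
by rewrite !mxE scalerDl scalerA.
Qed.
HB.instance Definition _ m := GRing.isLinear.Build C 'rV[C]_m {mpoly C[m]} _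
  (@lin_mpoly m) (@lin_mpoly_linear m).

Lemma lin_mpoly_homog m (x : 'rV[C]_m) : lin_mpoly x \is 1.-homog.
Proof. by apply: rpred_sum => a _; apply: rpredZ; rewrite dhomogX /= mdeg1. Qed.

Lemma meval_lin_mpoly m (x : 'rV[C]_m) v :
  (lin_mpoly x).@[v] = \sum_a x 0 a * v a.
Proof.
rewrite /lin_mpoly raddf_sum; apply: eq_bigr => a _.
by rewrite /= mevalZ mevalXU.
Qed.

Lemma lin_mpoly_delta m a : lin_mpoly (delta_mx 0 a : 'rV[C]_m) = 'X_a.
Proof.
rewrite /lin_mpoly (bigD1 a) //= big1 => [|b /negPf nb]; rewrite mxE eqxx /=.
  by rewrite eqxx scale1r addr0.
by rewrite nb scale0r.
Qed.

Definition quad_mpoly m (S : 'M[C]_m) : {mpoly C[m]} :=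
  \sum_a \sum_b S a b *: ('X_a * 'X_b).

Lemma quad_mpoly_linear m : linear (@quad_mpoly m).
Proof.
move=> c S T; rewrite /quad_mpoly scaler_sumr -big_split; apply: eq_bigr => a _.
rewrite /= scaler_sumr -big_split; apply: eq_bigr => b _.
by rewrite !mxE scalerDl scalerA.
Qed.
HB.instance Definition _ m := GRing.isLinear.Build C 'M[C]_m {mpoly C[m]} _
  (@quad_mpoly m) (@quad_mpoly_linear m).

Lemma quad_mpoly_outer m (x z : 'rV[C]_m) :
  quad_mpoly (x^T *m z) = lin_mpoly x * lin_mpoly z.
Proof.
rewrite /quad_mpoly mulr_suml; apply: eq_bigr => a _.
rewrite mulr_sumr; apply: eq_bigr => b _.
by rewrite mxE big_ord1 mxE -scalerAl -scalerAr scalerA.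
Qed.

Lemma quad_mpoly_homog m (S : 'M[C]_m) : quad_mpoly S \is 2.-homog.
Proof.
apply: rpred_sum => a _; apply: rpred_sum => b _; apply: rpredZ.
by apply: (@dhomogM _ _ mdeg 1 _ 1); rewrite dhomogX /= mdeg1.
Qed.
End QuadraticForms.

(** * Squares of the linear forms *)

Lemma mul_col (R : pzSemiRingType) m p q (A : 'M[R]_(m, p)) (B : 'M_(p, q)) j :
  A *m col j B = col j (A *m B).
Proof. by rewrite !colE mulmxA. Qed.

Section Equations.
Variable C : numClosedFieldType.
Variables n k s : nat.
Variable ell : 'I_n.+1 -> 'rV[C]_k.+1.
Local Notation Q0 := (pid_mx s : 'M[C]_k.+1).
Hypothesis s2 : (2 <= s)%N.
Hypothesis sk : (s <= k.+1)%N.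
Hypothesis ellQ : forall Q : 'M[C]_k.+1, Q^T = Q ->
  ((forall i, bil Q (ell i) (ell i) = 0) <-> exists c, Q = c *: Q0).

(** The matrix of the quadratic form with value sum_i c_i ell_i(w)^2 at w. *)
Definition sum_outer (c : 'rV[C]_n.+1) : 'M[C]_k.+1 :=
  \sum_i c 0 i *: ((ell i)^T *m ell i).

Lemma sum_outer_linear : linear sum_outer.
Proof.
move=> a c d; rewrite /sum_outer scaler_sumr -big_split; apply: eq_bigr => i _.
by rewrite !mxE scalerDl scalerA.
Qed.
HB.instance Definition _ := GRing.isLinear.Build C 'rV[C]_n.+1 'M[C]_k.+1 _
  sum_outer sum_outer_linear.

(** Flattening the squares ell_i^2 into rows turns questions on their span into row space
    membership, tested by a cokernel. *)
Definition outer_mx := \matrix_(i < n.+1) mxvec ((ell i)^T *m ell i).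

Lemma mul_outer_mx c : c *m outer_mx = mxvec (sum_outer c).
Proof.
rewrite mulmx_sum_row raddf_sum; apply: eq_bigr => i _.
by rewrite /= linearZ /= rowK.
Qed.

Lemma outer_mx_dot u i : (u *m outer_mx^T) 0 i = bil (vec_mx u) (ell i) (ell i).
Proof.
have -> : (u *m outer_mx^T) 0 i = (row i outer_mx *m u^T) 0 0.
  by rewrite !mxE; apply: eq_bigr => j _; rewrite !mxE mulrC.
by rewrite rowK -{1}[u]vec_mxK mxvec_dotmul.
Qed.

(** By duality: a functional killing all ell_i^2 is a quadric through Z, hence a multiple of Q0, and
    so kills the product of x and z. *)
Lemma orthogonal_sum_outer x z : bil Q0 x z = 0 ->
  exists c, sum_outer c = symm_part (x^T *m z).
Proof.
move=> Qxz; suff /submxP[c ec] : (mxvec (symm_part (x^T *m z)) <= outer_mx)%MS.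
  by exists c; apply: (can_inj mxvecK); rewrite -mul_outer_mx.
rewrite submxE; apply/eqP/rowP=> j; rewrite [RHS]mxE.
pose u := (col j (cokermx outer_mx))^T.
have Z i : bil (symm_part (vec_mx u)) (ell i) (ell i) = 0.
  rewrite bil_symm_part_diag -outer_mx_dot -[u *m _]trmxK trmx_mul !trmxK mxE.
  by rewrite mul_col mulmx_coker col0 mxE.
have [c ec] := (ellQ (symm_part_sym _)).1 Z.
have <- : bil (symm_part (vec_mx u)) x z = 0 by rewrite ec bil_mxZ Qxz mulr0.
have -> N : (mxvec N *m cokermx outer_mx) 0 j = (mxvec N *m u^T) 0 0.
  by rewrite trmxK mul_col [RHS]mxE.
rewrite -{1}[u]vec_mxK bil_symm_part /symm_part trmx_mul trmxK !linearZ !linearD /=.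
by rewrite -scalemxAl mxE mulmxDl mxE !mxvec_dotmul.
Qed.

(** A vector orthogonal to all relations among the rows of [outer_mx] lies in its column space; the
    coefficients, reshaped and symmetrized, form A. *)
Lemma sum_outer_annihilator (y : 'rV[C]_n.+1) :
    (forall c, sum_outer c = 0 -> \sum_i c 0 i * y 0 i = 0) ->
  exists2 A : 'M[C]_k.+1, A^T = A & forall i, y 0 i = bil A (ell i) (ell i).
Proof.
move=> ann; suff /submxP[u ->] : (y <= outer_mx^T)%MS.
  exists (symm_part (vec_mx u)); first exact: symm_part_sym.
  by move=> i; rewrite bil_symm_part_diag outer_mx_dot.
rewrite submxE; apply/eqP/rowP=> j; rewrite [RHS]mxE.
pose c := (col j (cokermx outer_mx^T))^T.
have c0 : sum_outer c = 0.
  apply: (can_inj mxvecK); rewrite -mul_outer_mx raddf0 /c.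
  by rewrite -[_ *m _]trmxK trmx_mul !trmxK mul_col mulmx_coker col0 trmx0.
by rewrite -[RHS](ann _ c0) mxE; apply: eq_bigr => i _; rewrite !mxE mulrC.
Qed.

(** Both sides are the trace pairing of A with the same symmetric matrix. *)
Lemma bil_sum_outer A c :
  A^T = A -> forall x z, sum_outer c = symm_part (x^T *m z) ->
  \sum_i c 0 i * bil A (ell i) (ell i) = bil A x z.
Proof.
move=> sA x z e.
have tr u v : bil A u v = \tr (u^T *m v *m A).
  by rewrite -mulmxA mxtrace_mulC trace_mx11 (bilC _ _ sA).
transitivity (\tr (sum_outer c *m A)).
  rewrite mulmx_suml raddf_sum; apply: eq_bigr => i _.
  by rewrite /= -scalemxAl mxtraceZ tr.
rewrite e -scalemxAl mxtraceZ mulmxDl mxtraceD trmx_mul trmxK -!tr (bilC z x sA).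
by field.
Qed.

Definition sq_fun (c : 'rV[C]_n.+1) : dhomog k.+1 C 2 :=
  indhomog 2 (quad_mpoly (sum_outer c)).

Lemma sq_fun_linear : linear sq_fun.
Proof.
by apply: (@indhomog_linear C _ _ _ (@quad_mpoly C k.+1 \o sum_outer)) => c;
  apply: quad_mpoly_homog.
Qed.
HB.instance Definition _ := GRing.isLinear.Build C 'rV[C]_n.+1 (dhomog k.+1 C 2) _
  sq_fun sq_fun_linear.

(** Its image is the hyperplane V, and its kernel consists of the linear relations among the
    ell_i^2. *)
Definition sq_map : 'Hom('rV[C]_n.+1, dhomog k.+1 C 2) := linfun sq_fun.

Lemma val_sq_map c : val (sq_map c) = quad_mpoly (sum_outer c).
Proof. by rewrite lfunE /= indhomogK // quad_mpoly_homog. Qed.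

Lemma quad_mpoly_sum_outer c : quad_mpoly (sum_outer c)
  = \sum_i c 0 i *: (lin_mpoly (ell i) * lin_mpoly (ell i)).
Proof.
rewrite [LHS]raddf_sum; apply: eq_bigr => i _.
by rewrite /= linearZ /= quad_mpoly_outer.
Qed.

Lemma val_sq_map_symm c x z : sum_outer c = symm_part (x^T *m z) ->
  val (sq_map c) = lin_mpoly x * lin_mpoly z.
Proof.
move=> ec; rewrite val_sq_map ec linearZ linearD /= trmx_mul trmxK !quad_mpoly_outer.
rewrite [X in _ + X]mulrC -mulr2n -scaler_nat scalerA mulVf ?scale1r //.
by rewrite pnatr_eq0.
Qed.

Lemma vhomog_orthogonal x z : bil Q0 x z = 0 ->
  vhomog (limg sq_map) (lin_mpoly x * lin_mpoly z).
Proof.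
case/orthogonal_sum_outer => c /val_sq_map_symm <-; exists (sq_map c) => //.
exact/memv_img/memvf.
Qed.

Lemma vhomog_good_monomial (a b : 'I_k.+1) : ~~ ((a == b) && (a < s)%N) ->
  vhomog (limg sq_map) ('X_a * 'X_b).
Proof.
move=> ab; rewrite -!lin_mpoly_delta; apply: vhomog_orthogonal.
by rewrite bil_delta_pid (negPf ab).
Qed.

Lemma vhomog_sub_squares (a b : 'I_k.+1) : (a < s)%N -> (b < s)%N ->
  vhomog (limg sq_map) ('X_a * 'X_a - 'X_b * 'X_b).
Proof.
move=> sa sb; have [->|ab] := eqVneq a b.
  by rewrite subrr; exists 0; rewrite ?rpred0.
have -> : 'X_a * 'X_a - 'X_b * 'X_b = lin_mpoly (delta_mx 0 a - delta_mx 0 b)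
    * lin_mpoly (delta_mx 0 a + delta_mx 0 b) :> {mpoly C[k.+1]}.
  by rewrite linearB linearD /= !lin_mpoly_delta; ring.
apply: vhomog_orthogonal; rewrite !bil_lin !bil_delta_pid sa sb !eqxx.
by rewrite (eq_sym b a) (negPf ab); ring.
Qed.

(* The functional q |-> \sum_(a < s) q(e_a) kills every ell_i^2 because Q0 vanishes
   on Z. *)
Lemma square_notin_sq_map p : p \in limg sq_map -> val p <> 'X_ord0 * 'X_ord0.
Proof.
case/memv_imgP => c _ ->; rewrite val_sq_map => e.
pose F (q : {mpoly C[k.+1]}) := \sum_(a < k.+1 | (a < s)%N) q.@[fun b => (b == a)%:R].
have F0 : F ('X_ord0 * 'X_ord0) = 1.
  rewrite /F (bigD1 ord0) ?(ltnW s2) //= big1 => [|a /andP[_ na]].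
    by rewrite mevalM mevalXU mulr1 addr0.
  by rewrite mevalM mevalXU eq_sym (negPf na) mulr0.
suff : F (quad_mpoly (sum_outer c)) = 0 by rewrite e F0 => /eqP; rewrite oner_eq0.
transitivity (\sum_i c 0 i * bil Q0 (ell i) (ell i)); last first.
  rewrite big1 // => i _; have ->: bil Q0 (ell i) (ell i) = 0; last exact: mulr0.
  by apply (ellQ (tr_pid_mx _ _ _ _)); exists 1; rewrite scale1r.
rewrite /F quad_mpoly_sum_outer; under eq_bigr do rewrite raddf_sum /=.
rewrite exchange_big; apply: eq_bigr => i _ /=.
under eq_bigr do rewrite mevalZ mevalM !meval_lin_mpoly.
rewrite -mulr_sumr; congr (_ * _); rewrite /bil mxE.
rewrite big_mkcond; apply: eq_bigr => a _; rewrite !mxE.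
have E (x : 'rV[C]_k.+1) : \sum_b x 0 b * (b == a)%:R = x 0 a.
  rewrite (bigD1 a) //= big1 ?eqxx ?mulr1 ?addr0 // => b /negPf->; exact: mulr0.
rewrite !E; case: ifP => sa.
  congr (_ * _); rewrite -(E (ell i)); apply: eq_bigr => b _.
  rewrite mxE -val_eqE /=; case: eqP => [->|//]; by rewrite sa.
rewrite big1 ?mul0r // => b _; rewrite mxE.
by case: eqP => [->|]; rewrite ?sa mulr0.
Qed.

(** Modulo V the squares X_a^2 with a < s all agree and the other quadratic monomials vanish, so
    X_0^2 spans a complement of V. *)
Lemma dim_sq_map : (\dim (limg sq_map)).+1 = 'C(k.+2, 2).
Proof.
pose p : dhomog k.+1 C 2 := indhomog 2 ('X_ord0 * 'X_ord0).
have hp : val p = 'X_ord0 * 'X_ord0.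
  rewrite indhomogK //; apply: (@dhomogM _ _ mdeg 1 _ 1); by rewrite dhomogX /= mdeg1.
have full : (limg sq_map + <[p]>)%VS = fullv.
  apply: vhomog_full => m /mnm_cons[a [m' -> /mnm_cons[b [m'']]]] -> /eqP.
  rewrite mdeg_eq0 => /eqP->; rewrite !mpolyXD mpolyX0 mulr1.
  have [/andP[/eqP<- sa]|] := boolP ((a == b) && (a < s)%N); last first.
    by move/vhomog_good_monomial; apply/vhomogS/addvSl.
  rewrite -['X_a * _](subrK ('X_ord0 * 'X_ord0)); apply: vhomogD.
    apply: (vhomogS (addvSl _ _)); apply: vhomog_sub_squares => //; exact: ltnW.
  by apply: (vhomogS (addvSr _ _)); exists p; rewrite ?memv_line.
have pV : p \notin limg sq_map by apply/negP => /square_notin_sq_map; apply.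
have dp : \dim <[p]> = 1%N.
  by rewrite dim_vline (contraNneq _ pV) // => ->; apply: rpred0.
rewrite -(dim_dhomog C k 2) -full dimv_disjoint_sum ?dp ?addn1 //.
apply/eqP; rewrite -subv0; apply/subvP => u; rewrite memv_cap memv0.
case/andP => uV /vlineP[c eu]; rewrite eu scaler_eq0; apply: contraR pV.
rewrite negb_or => /andP[nc _]; rewrite -[p](scalerK nc) -eu; exact: rpredZ.
Qed.
End Equations.

(** * Quadratic relations among the squares *)

Section Substitution.
Variable C : numClosedFieldType.
Variables k r : nat.
Variable vs : r.+1.-tuple (dhomog k.+1 C 2).

Definition basis_subst : r.+1.-tuple {mpoly C[k.+1]} :=
  [tuple val (tnth vs j) | j < r.+1].

Lemma basis_subst_homog d (p : {mpoly C[r.+1]}) :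
  p \is d.-homog -> p \mPo basis_subst \is (d * 2).-homog.
Proof.
move=> hp; apply: comp_mpoly_homog hp _ => i; rewrite tnth_mktuple.
exact: dhomog_is_dhomog.
Qed.

Definition subst_fun (p : dhomog r.+1 C 2) : dhomog k.+1 C 4 :=
  indhomog 4 (val p \mPo basis_subst).

Lemma val_subst_fun p : val (subst_fun p) = val p \mPo basis_subst.
Proof. by rewrite indhomogK // (basis_subst_homog (dhomog_is_dhomog p)). Qed.

Lemma subst_fun_linear : linear subst_fun.
Proof.
move=> c p q; apply/val_inj; rewrite val_subst_fun /=.
by rewrite linearP /= -!val_subst_fun.
Qed.
HB.instance Definition _ := GRing.isLinear.Build C (dhomog r.+1 C 2)
  (dhomog k.+1 C 4) _ subst_fun subst_fun_linear.

(** When [vs] is a basis of V, this is the multiplication map Sym^2 V -> Sym^4 W^* in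
    coordinates. *)
Definition subst_map : 'Hom(dhomog r.+1 C 2, dhomog k.+1 C 4) := linfun subst_fun.

Lemma val_subst_map p : val (subst_map p) = val p \mPo basis_subst.
Proof. by rewrite lfunE val_subst_fun. Qed.

Definition coord_mpoly (p : dhomog k.+1 C 2) : {mpoly C[r.+1]} :=
  lin_mpoly (\row_j coord vs j p).

Lemma comp_coord_mpoly p : p \in <<vs>>%VS -> coord_mpoly p \mPo basis_subst = val p.
Proof.
move=> /coord_span {2}->; rewrite raddf_sum [RHS]raddf_sum; apply: eq_bigr => j _ /=.
rewrite linearZ /= comp_mpolyXU mxE -(tnth_nth 0 vs); congr (_ *: _).
by rewrite -(tnth_nth 0 basis_subst) tnth_mktuple.
Qed.

Lemma coord_mpolyM_homog p q : coord_mpoly p * coord_mpoly q \is 2.-homog.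
Proof. by apply: (@dhomogM _ _ mdeg 1 _ 1); apply: lin_mpoly_homog. Qed.

Lemma vhomog_subst_mul p q :
  vhomog <<vs>> p -> vhomog <<vs>> q -> vhomog (limg subst_map) (p * q).
Proof.
move=> [u uV <-] [v vV <-].
exists (subst_map (indhomog 2 (coord_mpoly u * coord_mpoly v))).
  exact/memv_img/memvf.
by rewrite val_subst_map indhomogK ?coord_mpolyM_homog // rmorphM /= !comp_coord_mpoly.
Qed.

Lemma dim_lker_subst_map :
  (\dim (lker subst_map) + \dim (limg subst_map))%N = 'C(r.+2, 2).
Proof.
by rewrite -{1}[lker _]capfv -[limg _]/(subst_map @: fullv)%VS limg_ker_dim dim_dhomog.
Qed.
End Substitution.

(** * The rank of the multiplication map on Sym^2 V *)

Section Surjectivity.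
Variable C : numClosedFieldType.
Variables n k s r : nat.
Variable ell : 'I_n.+1 -> 'rV[C]_k.+1.
Local Notation Q0 := (pid_mx s : 'M[C]_k.+1).
Hypothesis s2 : (2 <= s)%N.
Hypothesis sk : (s <= k.+1)%N.
Hypothesis ellQ : forall Q : 'M[C]_k.+1, Q^T = Q ->
  ((forall i, bil Q (ell i) (ell i) = 0) <-> exists c, Q = c *: Q0).
Variable vs : r.+1.-tuple (dhomog k.+1 C 2).
Hypothesis vsV : <<vs>>%VS = limg (sq_map ell).

Lemma subst_map_pairs (a b c d : 'I_k.+1) :
    ~~ ((a == b) && (a < s)%N) -> ~~ ((c == d) && (c < s)%N) ->
  vhomog (limg (subst_map vs)) ('X_a * 'X_b * ('X_c * 'X_d)).
Proof.
by move=> ab cd; apply: vhomog_subst_mul; rewrite vsV;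
  apply: (vhomog_good_monomial ellQ).
Qed.

(* A product of four variables can be split into two products of two variables
   lying in the span of the squares, unless some X_a with a < s occurs three times. *)
Lemma subst_map_span (W : {vspace dhomog k.+1 C 4}) :
    (limg (subst_map vs) <= W)%VS ->
    (forall a b : 'I_k.+1, (a < s)%N -> vhomog W ('X_a * 'X_a * ('X_a * 'X_b))) ->
  W = fullv.
Proof.
move=> sW cub; apply: vhomog_full => m.
move=> /mnm_cons[a [? -> /mnm_cons[b [? -> /mnm_cons[c [? -> /mnm_cons[d [m' ->]]]]]]]].
move=> /eqP; rewrite mdeg_eq0 => /eqP->; rewrite !mpolyXD mpolyX0 mulr1.
rewrite mulrA.
have good := fun a b c d ab cd => vhomogS sW (@subst_map_pairs a b c d ab cd).
have ACA : 'X_a * 'X_b * ('X_c * 'X_d) = 'X_a * 'X_c * ('X_b * 'X_d) :> {mpoly C[k.+1]}.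
  exact: mulrACA.
have [/andP[/eqP ab sa]|nab] := boolP ((a == b) && (a < s)%N).
  have [/andP[/eqP ac _]|nac] := boolP ((a == c) && (a < s)%N).
    by rewrite -ab -ac; apply: cub.
  have [/andP[/eqP bd _]|nbd] := boolP ((b == d) && (b < s)%N).
    by rewrite -bd -ab ['X_c * _]mulrC; apply: cub.
  by rewrite ACA; apply: good.
have [/andP[/eqP cd sc]|ncd] := boolP ((c == d) && (c < s)%N); last exact: good.
have [/andP[/eqP ac _]|nac] := boolP ((a == c) && (a < s)%N).
  by rewrite ac -cd mulrC; apply: cub.
have [/andP[/eqP bd _]|nbd] := boolP ((b == d) && (b < s)%N).
  by rewrite bd -cd mulrC ['X_a * _]mulrC; apply: cub.
by rewrite ACA; apply: good.
Qed.

(** Trading X_a^2 for X_l^2 costs a product of two elements of V and leaves X_a X_l X_b X_l, which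
    splits into two mixed products. *)
Lemma subst_map_cube (a b l : 'I_k.+1) : (a < s)%N -> (l < s)%N ->
    a != b -> a != l -> b != l ->
  vhomog (limg (subst_map vs)) ('X_a * 'X_a * ('X_a * 'X_b)).
Proof.
move=> sa sl ab al bl.
have -> : 'X_a * 'X_a * ('X_a * 'X_b) = ('X_a * 'X_a - 'X_l * 'X_l) * ('X_a * 'X_b)
   + 'X_a * 'X_l * ('X_b * 'X_l) :> {mpoly C[k.+1]} by ring.
apply: vhomogD; last by apply: subst_map_pairs; rewrite negb_and (al, bl).
apply: vhomog_subst_mul; rewrite vsV; first exact: (vhomog_sub_squares ellQ).
by apply: (vhomog_good_monomial ellQ); rewrite negb_and ab.
Qed.

Lemma limg_subst_map_full : (3 <= s)%N -> limg (subst_map vs) = fullv.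
Proof.
move=> s3; apply: subst_map_span => // a b sa.
have k2 : (2 < k.+1)%N by apply: leq_trans s3 sk.
(* Since s >= 3, two indices below s remain besides a: one avoids b when a and b differ, and both
   are used for X_a^4. *)
have [l [l' [sl sl' nal nal' nll']]] : exists l l' : 'I_k.+1,
   [/\ (l < s)%N, (l' < s)%N, a != l, a != l' & l != l'].
  pose i0 : 'I_k.+1 := Ordinal (ltnW (ltnW k2)).
  pose i1 : 'I_k.+1 := Ordinal (ltnW k2); pose i2 : 'I_k.+1 := Ordinal k2.
  have [->|n0] := eqVneq a i0; first by exists i1, i2; rewrite ?s3 ?s2.
  have [->|n1] := eqVneq a i1; first by exists i0, i2; rewrite ?s3 ?(ltnW s2).
  by exists i0, i1; rewrite ?s2 ?(ltnW s2).
have [<-|ab] := eqVneq a b; last first.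
  have [bl|bl] := eqVneq b l; last exact: (subst_map_cube (l := l)).
  by apply: (subst_map_cube (l := l')); rewrite // bl.
have -> : 'X_a * 'X_a * ('X_a * 'X_a) =
     ('X_a * 'X_a - 'X_l * 'X_l) * ('X_a * 'X_a - 'X_l' * 'X_l')
   + 'X_a * 'X_l * ('X_a * 'X_l) + 'X_a * 'X_l' * ('X_a * 'X_l')
   - 'X_l * 'X_l' * ('X_l * 'X_l') :> {mpoly C[k.+1]} by ring.
apply: vhomogB; last by apply: subst_map_pairs; rewrite negb_and nll'.
apply: vhomogD; last by apply: subst_map_pairs; rewrite negb_and nal'.
apply: vhomogD; last by apply: subst_map_pairs; rewrite negb_and nal.
by apply: vhomog_subst_mul; rewrite vsV; apply: (vhomog_sub_squares ellQ).
Qed.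

(** Only two indices lie below s, so no third one helps with X_0^4 and X_0^3 X_1; once these two are
    adjoined, every quartic monomial is reached. *)
Lemma dim_limg_subst_map_rank2 :
  s = 2%N -> ('C(k + 4, 4) <= \dim (limg (subst_map vs)) + 2)%N.
Proof.
move=> s_2; have k1 : (1 < k.+1)%N by rewrite -s_2.
pose i0 : 'I_k.+1 := Ordinal (ltnW k1); pose i1 : 'I_k.+1 := Ordinal k1.
have h4 (a b : 'I_k.+1) : ('X_a * 'X_a * ('X_a * 'X_b) : {mpoly C[k.+1]}) \is 4.-homog.
  by apply: (@dhomogM _ _ mdeg 2 _ 2); apply: (@dhomogM _ _ mdeg 1 _ 1);
    rewrite dhomogX /= mdeg1.
pose p a b : dhomog k.+1 C 4 := indhomog 4 ('X_a * 'X_a * ('X_a * 'X_b)).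
pose W := (limg (subst_map vs) + (<[p i0 i0]> + <[p i0 i1]>))%VS.
have sW : (limg (subst_map vs) <= W)%VS by apply: addvSl.
have W00 : vhomog W ('X_i0 * 'X_i0 * ('X_i0 * 'X_i0)).
  exists (p i0 i0); last exact: indhomogK.
  by rewrite (subvP (addvSr _ _)) // (subvP (addvSl _ _)) // memv_line.
have W01 : vhomog W ('X_i0 * 'X_i0 * ('X_i0 * 'X_i1)).
  exists (p i0 i1); last exact: indhomogK.
  by rewrite (subvP (addvSr _ _)) // (subvP (addvSr _ _)) // memv_line.
have s0 : (i0 < s)%N by rewrite s_2.
have s1 : (i1 < s)%N by rewrite s_2.
have Wfull : W = fullv.
  apply: subst_map_span => // a b sa.
  have [sb|sb] := ltnP b s; last first.
    have [l sl al] : exists2 l : 'I_k.+1, (l < s)%N & a != l.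
      by have [->|na] := eqVneq a i0; [exists i1|exists i0].
    apply: (vhomogS sW); apply: (subst_map_cube (l := l)) => //.
      by apply: contraTneq sa => ->; rewrite -leqNgt.
    by apply: contraTneq sl => <-; rewrite -leqNgt.
  have i01 (c : 'I_k.+1) : (c < s)%N -> c = i0 \/ c = i1.
    rewrite s_2; case: c => [[|[|]]] // ?; [left|right]; exact/val_inj.
  case: (i01 a sa) (i01 b sb) => -> [] -> //.
  - have -> : 'X_i1 * 'X_i1 * ('X_i1 * 'X_i0) =
       ('X_i1 * 'X_i1 - 'X_i0 * 'X_i0) * ('X_i1 * 'X_i0)
      + 'X_i0 * 'X_i0 * ('X_i0 * 'X_i1) :> {mpoly C[k.+1]} by ring.
    apply: vhomogD => //; apply: (vhomogS sW); apply: vhomog_subst_mul; rewrite vsV.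
      exact: (vhomog_sub_squares ellQ).
    exact: (vhomog_good_monomial ellQ).
  - have -> : 'X_i1 * 'X_i1 * ('X_i1 * 'X_i1) =
       ('X_i1 * 'X_i1 - 'X_i0 * 'X_i0) * ('X_i1 * 'X_i1 - 'X_i0 * 'X_i0)
      + 'X_i0 * 'X_i1 * ('X_i0 * 'X_i1) + 'X_i0 * 'X_i1 * ('X_i0 * 'X_i1)
      - 'X_i0 * 'X_i0 * ('X_i0 * 'X_i0) :> {mpoly C[k.+1]} by ring.
    apply: vhomogB => //; apply: (vhomogS sW).
    have W1 := @subst_map_pairs i0 i1 i0 i1 isT isT.
    apply: vhomogD => //; apply: vhomogD => //.
    by apply: vhomog_subst_mul; rewrite vsV; apply: (vhomog_sub_squares ellQ).
rewrite addnC -(dim_dhomog C k 4) -Wfull.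
apply: leq_trans (dimv_add_leqif _ _) _; rewrite leq_add2l.
by apply: leq_trans (dimv_add_leqif _ _) _; rewrite !dim_vline; do 2!case: eqP.
Qed.
End Surjectivity.

(** * The equations of the coordinate-wise square *)

(** With r + 1 = dim V, the left side is dim Sym^2 V - dim Sym^4 W^*, the size of the kernel when
    multiplication is onto. *)
Lemma num_quadratic_bin k r : r.+2 = 'C(k.+2, 2) ->
  'C(r.+2, 2)%:R - 'C(k + 4, 4)%:R = num_quadratic k.
Proof.
have bin_rat a b : (a.+1)%:R * 'C(a, b)%:R = (b.+1)%:R * 'C(a.+1, b.+1)%:R :> rat.
  by rewrite -!natrM mul_bin_diag.
have binE a b : 'C(a.+1, b.+1)%:R = (a%:R + 1) * 'C(a, b)%:R / (b%:R + 1) :> rat.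
  by rewrite !natr1 bin_rat mulrC mulKf // pnatr_eq0.
move=> er; have r_rat : r%:R = (k%:R + 2) * (k%:R + 1) / 2 - 2 :> rat.
  have := congr1 (fun a => a%:R : rat) er; rewrite /= !binE bin0 => e.
  have -> : r%:R = r.+2%:R - 2 :> rat by rewrite -addn2 natrD; ring.
  by rewrite e -!natr1; field.
by rewrite addn4 !binE !bin0 /num_quadratic -!natr1 r_rat; field.
Qed.

Section Core.
Variable C : numClosedFieldType.
Variables n k s r : nat.
Variable ell : 'I_n.+1 -> 'rV[C]_k.+1.
Local Notation Q0 := (pid_mx s : 'M[C]_k.+1).
Hypothesis s2 : (2 <= s)%N.
Hypothesis sk : (s <= k.+1)%N.
Hypothesis ellQ : forall Q : 'M[C]_k.+1, Q^T = Q ->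
  ((forall i, bil Q (ell i) (ell i) = 0) <-> exists c, Q = c *: Q0).
Variable vs : r.+1.-tuple (dhomog k.+1 C 2).
Hypothesis vsV : basis_of (limg (sq_map ell)) vs.

Let vs_span : <<vs>>%VS = limg (sq_map ell).
Proof. exact: span_basis vsV. Qed.

Let dim_r : r.+2 = 'C(k.+2, 2).
Proof. by rewrite -(dim_sq_map s2 ellQ) -(vector.size_basis vsV). Qed.

Definition lin_eqs : seq {mpoly C[n.+1]} :=
  [seq lin_mpoly c | c <- vbasis (lker (sq_map ell))].

(** Rank-nullity: n + 1 minus dim V, where dim V = r + 1 is one less than the binomial
    coefficient. *)
Lemma size_lin_eqs : (size lin_eqs)%:R = num_linear n k.
Proof.
have := limg_ker_dim (sq_map ell) fullv; rewrite capfv dimvf /dim /= mul1n.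
have dr := vector.size_basis vsV; rewrite dr size_map size_tuple => e.
rewrite /num_linear -dim_r; move: (\dim (lker _)) e => d.
move=> /(congr1 (fun a => a%:R : rat)); rewrite /= natrD -!natr1 => e.
by rewrite -[d%:R](addrK (r%:R + 1)) e; ring.
Qed.

(* The value of the j-th form at phi2 (embed ell w) is that of tnth vs j at w. *)
Definition subst_lift : r.+1.-tuple {mpoly C[n.+1]} :=
  [tuple lin_mpoly (((sq_map ell)^-1)%VF (tnth vs j)) | j < r.+1].

Definition quad_eqs : seq {mpoly C[n.+1]} :=
  [seq val b \mPo subst_lift | b <- vbasis (lker (subst_map vs))].

Lemma size_quad_eqs_full : (3 <= s)%N -> (size quad_eqs)%:R = num_quadratic k.
Proof.
move=> s3; rewrite size_map size_tuple -(num_quadratic_bin dim_r).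
rewrite -(dim_lker_subst_map vs) (limg_subst_map_full _ _ ellQ vs_span) //.
by rewrite dim_dhomog natrD (addnC 4) addrK.
Qed.

(** The kernel exceeds the expected dimension by at most 2; [pad] is what is missing to reach
    exactly 2. *)
Lemma size_quad_eqs_rank2 : s = 2%N ->
  exists pad, (size quad_eqs + pad)%:R = num_quadratic k + 2%:R :> rat.
Proof.
move=> s_2; have le2 := dim_limg_subst_map_rank2 sk ellQ vs_span s_2.
have e := dim_lker_subst_map vs.
exists (\dim (limg (subst_map vs)) + 2 - 'C(k + 4, 4))%N.
rewrite size_map size_tuple natrD natrB // natrD -(num_quadratic_bin dim_r) -e natrD.
ring.
Qed.

Lemma lin_eqs_homog : {in lin_eqs, forall f, f \is 1.-homog}.
Proof. by move=> f /mapP[c _ ->]; apply: lin_mpoly_homog. Qed.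

Lemma quad_eqs_homog : {in quad_eqs, forall f, f \is 2.-homog}.
Proof.
move=> f /mapP[b _ ->]; rewrite -[2%N]/(2 * 1)%N.
apply: comp_mpoly_homog (dhomog_is_dhomog b) _ => j.
by rewrite tnth_mktuple lin_mpoly_homog.
Qed.

Lemma meval_lin_phi2 c w :
  (lin_mpoly c).@[phi2 (embed ell w) 0]
    = (val (sq_map ell c)).@[fun a => w a 0].
Proof.
rewrite meval_lin_mpoly val_sq_map quad_mpoly_sum_outer [RHS]raddf_sum.
apply: eq_bigr => i _; rewrite /= mevalZ mevalM !mxE -expr2 meval_lin_mpoly.
by congr (_ * _ ^+ 2).
Qed.

Lemma phi2_vanish_lin w : vanish_at lin_eqs (phi2 (embed ell w)).
Proof.
move=> f /mapP[c /vbasis_mem]; rewrite memv_ker => /eqP c0 ->.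
by rewrite meval_lin_phi2 c0 meval0.
Qed.

Lemma phi2_vanish_quad w : vanish_at quad_eqs (phi2 (embed ell w)).
Proof.
move=> f /mapP[b /vbasis_mem]; rewrite memv_ker => /eqP b0 ->.
have := congr1 (fun p => (val p).@[fun a => w a 0]) b0.
rewrite /= val_subst_map meval0 !comp_mpoly_meval => <-.
apply: meval_eq => j; rewrite !tnth_mktuple meval_lin_phi2 limg_lfunVK //.
by rewrite -vs_span memv_span // mem_tnth.
Qed.

Section Zeros.
Variable y : 'rV[C]_n.+1.
Hypothesis y_lin : vanish_at lin_eqs y.
Hypothesis y_quad : vanish_at quad_eqs y.

Lemma lin_eqs_ker c : sq_map ell c = 0 -> (lin_mpoly c).@[y 0] = 0.
Proof.
move=> c0; have /coord_vbasis -> : c \in lker (sq_map ell) by rewrite memv_ker c0.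
rewrite [lin_mpoly _]raddf_sum [LHS]raddf_sum big1 // => j _ /=.
rewrite linearZ mevalZ y_lin ?mulr0 //.
by apply: map_f; rewrite -tnth_nth mem_tnth.
Qed.

Lemma quad_eqs_ker b : subst_map vs b = 0 -> (val b \mPo subst_lift).@[y 0] = 0.
Proof.
move=> b0; have /coord_vbasis -> : b \in lker (subst_map vs) by rewrite memv_ker b0.
rewrite [val _]raddf_sum [_ \mPo _]raddf_sum [LHS]raddf_sum big1 // => j _ /=.
rewrite linearZ mevalZ y_quad ?mulr0 //.
by apply: (map_f (fun b => val b \mPo subst_lift)); rewrite -tnth_nth mem_tnth.
Qed.

(** Two preimages of an element of V differ by a linear relation among the squares, and such
    relations vanish at y. *)
Lemma meval_coord_mpoly c :
  (coord_mpoly vs (sq_map ell c) \mPo subst_lift).@[y 0] = (lin_mpoly c).@[y 0].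
Proof.
set p := sq_map ell c; have pV : p \in limg (sq_map ell) by apply/memv_img/memvf.
pose ev (c : 'rV[C]_n.+1) : C := (lin_mpoly c).@[y 0].
have -> : (coord_mpoly vs p \mPo subst_lift).@[y 0] = ev (((sq_map ell)^-1)%VF p).
  rewrite {2}(coord_basis vsV pV) /coord_mpoly {1}/lin_mpoly.
  rewrite [_ \mPo _]raddf_sum [LHS]raddf_sum [(_^-1)%VF _]raddf_sum /ev.
  rewrite [lin_mpoly (\sum_i _)]raddf_sum [RHS]raddf_sum; apply: eq_bigr => j _ /=.
  rewrite comp_mpolyZ mevalZ [(_^-1)%VF _]linearZ [lin_mpoly (_ *: _)]linearZ /=.
  rewrite mevalZ mxE comp_mpolyXU -(tnth_nth 0 subst_lift) tnth_mktuple.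
  by rewrite (tnth_nth 0).
apply/eqP; rewrite -subr_eq0 -mevalB -linearB; apply/eqP/lin_eqs_ker.
by rewrite linearB /= limg_lfunVK // subrr.
Qed.

(** The linear equations yield A. Each minor is the value at y of a quadratic form on V^* that
    restricts to (x1 z1)(x2 z2) - (x1 z2)(x2 z1) = 0, hence lies in the kernel defining the
    quadrics. *)
Lemma zeros_orthogonal_minors : exists A : 'M[C]_k.+1,
  [/\ A^T = A, forall i, y 0 i = bil A (ell i) (ell i) & orthogonal_minors Q0 A].
Proof.
have [|A sA yA] := @sum_outer_annihilator C n k ell y.
  move=> c c0; rewrite -meval_lin_mpoly lin_eqs_ker //; apply: val_inj.
  by rewrite val_sq_map c0 raddf0.
exists A; split=> // x1 x2 z1 z2 Q11 Q12 Q21 Q22.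
have form x z : bil Q0 x z = 0 -> exists2 c, (lin_mpoly c).@[y 0] = bil A x z
    & val (sq_map ell c) = lin_mpoly x * lin_mpoly z.
  case/(orthogonal_sum_outer ellQ) => c ec; exists c; last exact: val_sq_map_symm.
  rewrite meval_lin_mpoly -(bil_sum_outer sA ec); apply: eq_bigr => i _.
  by rewrite yA.
have [[c11 y11 v11] [c12 y12 v12]] := (form _ _ Q11, form _ _ Q12).
have [[c21 y21 v21] [c22 y22 v22]] := (form _ _ Q21, form _ _ Q22).
pose g c := coord_mpoly vs (sq_map ell c).
have hq : g c11 * g c22 - g c12 * g c21 \is 2.-homog.
  by apply: rpredB; apply: coord_mpolyM_homog.
have cg c : g c \mPo basis_subst vs = val (sq_map ell c).
  by apply: comp_coord_mpoly; rewrite vs_span; apply/memv_img/memvf.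
have := @quad_eqs_ker (indhomog 2 (g c11 * g c22 - g c12 * g c21)) _.
rewrite indhomogK // !rmorphB !rmorphM /= !meval_coord_mpoly y11 y12 y21 y22.
move=> e; apply/subr0_eq/e/val_inj; rewrite val_subst_map indhomogK //.
rewrite !rmorphB !rmorphM /= !cg v11 v12 v21 v22 /=; ring.
Qed.

(** Q0 vanishes at every ell_i, so only the squares of the values of ell_i at w^T remain. *)
Lemma rank1_mod_phi2 (A : 'M[C]_k.+1) :
    (forall i, y 0 i = bil A (ell i) (ell i)) -> rank1_mod Q0 A ->
  exists w, y = phi2 (embed ell w).
Proof.
move=> yA [t [w eA]]; exists w^T; apply/rowP => i; rewrite yA eA bil_mxD bil_mxZ.
have -> : bil Q0 (ell i) (ell i) = 0.
  by apply (ellQ (tr_pid_mx _ _ _ _)); exists 1; rewrite scale1r.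
rewrite mulr0 add0r bil_rank1 !mxE expr2; congr (_ * _).
by apply: eq_bigr => a _; rewrite !mxE mulrC.
Qed.
End Zeros.
End Core.

(** * The equations for each rank *)

Section CutOut.
Variable C : numClosedFieldType.
Variables n k s : nat.
Variable ell : 'I_n.+1 -> 'rV[C]_k.+1.
Local Notation Q0 := (pid_mx s : 'M[C]_k.+1).
Hypothesis s2 : (2 <= s)%N.
Hypothesis sk : (s <= k.+1)%N.
Hypothesis ellQ : forall Q : 'M[C]_k.+1, Q^T = Q ->
  ((forall i, bil Q (ell i) (ell i) = 0) <-> exists c, Q = c *: Q0).
Variable L : {vspace 'rV[C]_n.+1}.
Hypothesis ellL : forall x, x \in L <-> exists w, x = embed ell w.

(** A square root of the projective factor c is absorbed into w. *)
Lemma coord_square_phi2 y :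
  y != 0 -> (coord_square L y <-> exists w, y = phi2 (embed ell w)).
Proof.
move=> nzy; split=> [[x [/ellL[w ->] _ [c _ ->]]]|[w ew]].
  exists (sqrtC c *: w); apply/rowP => i.
  rewrite [LHS]mxE [RHS]mxE [phi2 _ _ _]mxE !(mxE _ (fun _ i => (ell i *m _) 0 0)).
  by rewrite -scalemxAr [X in _ = X ^+ 2]mxE exprMn sqrtCK.
exists (embed ell w); split; first by apply/ellL; exists w.
  apply: contra_neq nzy => e0; rewrite ew e0.
  by apply/rowP => i; rewrite !mxE expr0n.
by exists 1; rewrite ?oner_neq0 // scale1r.
Qed.

Lemma basis_sq_map : exists r, exists vs : r.+1.-tuple (dhomog k.+1 C 2),
  basis_of (limg (sq_map ell)) vs.
Proof.
have [r dr] : exists r, \dim (limg (sq_map ell)) = r.+1.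
  have := dim_sq_map s2 ellQ; case: (\dim _) => [|r] e; last by exists r.
  have k1 : (1 < k.+1)%N by apply: leq_trans s2 sk.
  (* Dimension zero is impossible: s >= 2 forces k >= 1, so the binomial coefficient exceeds 1. *)
  by move/eqP: e; rewrite binS bin1 -(subnKC k1) !addnS.
by exists r; rewrite -dr; exists (vbasis _); apply: vbasisP.
Qed.

Lemma vanish_at_cat (f g : seq {mpoly C[n.+1]}) y :
  vanish_at (f ++ g) y <-> vanish_at f y /\ vanish_at g y.
Proof.
split=> [v|[vf vg] h]; last by rewrite mem_cat => /orP[/vf|/vg].
by split=> h hh; apply: v; rewrite mem_cat hh ?orbT.
Qed.

Lemma cut_out_rank_ge4 : (4 <= s)%N ->
  cut_out_by_forms (coord_square L) (num_linear n k) (num_quadratic k) 0.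
Proof.
move=> s4; have [r [vs vsV]] := basis_sq_map.
exists (lin_eqs ell), (quad_eqs ell vs), [::]; split; [split=> //|split|].
- exact: (size_lin_eqs s2 ellQ vsV).
- by apply: (size_quad_eqs_full s2 sk ellQ vsV); apply: ltnW.
- exact: lin_eqs_homog.
- exact: quad_eqs_homog.
- by [].
move=> y /coord_square_phi2 ->; split=> [[w ->]|[ylin yquad _]].
  by split=> //; [apply: phi2_vanish_lin|apply: (phi2_vanish_quad vsV)].
have [A [sA yA omA]] := zeros_orthogonal_minors ellQ vsV ylin yquad.
by apply: (rank1_mod_phi2 ellQ yA); apply: orthogonal_minors_rank1.
Qed.

Lemma cut_out_rank2 : s = 2%N ->
  cut_out_by_forms (coord_square L) (num_linear n k) (num_quadratic k + 2%:R) 0.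
Proof.
move=> s_2; have [r [vs vsV]] := basis_sq_map.
have [pad ep] := size_quad_eqs_rank2 s2 sk ellQ vsV s_2.
(* Zero forms bring the number of quadrics to the exact count without changing the zero set. *)
exists (lin_eqs ell), (quad_eqs ell vs ++ nseq pad 0), [::].
split; [split=> //|split|].
- exact: (size_lin_eqs s2 ellQ vsV).
- by rewrite size_cat size_nseq.
- exact: lin_eqs_homog.
- move=> f; rewrite mem_cat => /orP[|/nseqP[-> _]]; first exact: quad_eqs_homog.
  exact: dhomog0.
- by [].
move=> y /coord_square_phi2 ->; split=> [[w ->]|[ylin /vanish_at_cat[yquad _] _]].
  split=> //; first exact: phi2_vanish_lin.
  apply/vanish_at_cat; split; first exact: (phi2_vanish_quad vsV).
  by move=> f /nseqP[-> _]; rewrite meval0.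
have [A [sA yA omA]] := zeros_orthogonal_minors ellQ vsV ylin yquad.
apply: (rank1_mod_phi2 ellQ yA); apply: orthogonal_minors_block => //.
move: (pid_mx s : 'M[C]_(s, k.+1)); rewrite s_2 => G.
by apply: sym2_rank1_mod; rewrite !trmx_mul trmxK sA mulmxA.
Qed.

Lemma cubic_minors_homog m (p q x z w : {mpoly C[m]}) :
    p \is 1.-homog -> q \is 1.-homog -> x \is 1.-homog -> z \is 1.-homog ->
    w \is 1.-homog ->
  {in cubic_minors p q x z w, forall f, f \is 3.-homog}.
Proof.
move=> hp hq hx hz hw f.
have M2 (a b : {mpoly C[m]}) : a \is 1.-homog -> b \is 1.-homog -> a * b \is 2.-homog.
  exact: dhomogM.
have M3 (a b : {mpoly C[m]}) : a \is 1.-homog -> b \is 2.-homog -> a * b \is 3.-homog.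
  exact: dhomogM.
have hD d (a b : {mpoly C[m]}) : a \is d.-homog -> b \is d.-homog -> a + b \is d.-homog.
  exact: rpredD.
have hB d (a b : {mpoly C[m]}) : a \is d.-homog -> b \is d.-homog -> a - b \is d.-homog.
  exact: rpredB.
rewrite /cubic_minors !inE => /orP[|/orP[|/orP[|/orP[|/orP[|/orP[]]]]]] /eqP->;
  by rewrite hB ?M3 ?hB ?hD ?hD ?M2.
Qed.

Lemma cut_out_rank3 : s = 3%N ->
  cut_out_by_forms (coord_square L) (num_linear n k) (num_quadratic k) 7%:R.
Proof.
move=> s_3; have [r [vs vsV]] := basis_sq_map.
pose o j : 'I_k.+1 := widen_ord sk (cast_ord (esym s_3) j).
have oE i j : (o i == o j) = (i == j) by rewrite -!val_eqE.
have os i : (o i < s)%N by rewrite /= s_3.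
(* The coefficients c are chosen before y and A, since the cubics must not depend on the point. *)
have form x z : bil Q0 x z = 0 -> exists c,
    forall (y : 'rV[C]_n.+1) (A : 'M_k.+1), A^T = A ->
    (forall i, y 0 i = bil A (ell i) (ell i)) -> (lin_mpoly c).@[y 0] = bil A x z.
  case/(orthogonal_sum_outer ellQ) => c ec; exists c => y A sA yA.
  rewrite meval_lin_mpoly -(bil_sum_outer sA ec); apply: eq_bigr => i _.
  by rewrite yA.
have offdiag i j : i != j -> exists c,
    forall (y : 'rV[C]_n.+1) (A : 'M_k.+1), A^T = A ->
    (forall i, y 0 i = bil A (ell i) (ell i)) -> (lin_mpoly c).@[y 0] = A (o i) (o j).
  move=> ij; have [|c ec] := form (delta_mx 0 (o i)) (delta_mx 0 (o j)).
    by rewrite bil_delta_pid oE (negPf ij).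
  by exists c => y A sA yA; rewrite (ec _ A) // bil_delta.
have diag i j : i != j -> exists c,
    forall (y : 'rV[C]_n.+1) (A : 'M_k.+1), A^T = A ->
    (forall i, y 0 i = bil A (ell i) (ell i)) ->
    (lin_mpoly c).@[y 0] = A (o i) (o i) - A (o j) (o j).
  move=> ij; have [|c ec] := form (delta_mx 0 (o i) - delta_mx 0 (o j))
                                 (delta_mx 0 (o i) + delta_mx 0 (o j)).
    by rewrite !bil_lin !bil_delta_pid !oE !os (eq_sym j) (negPf ij) !eqxx; ring.
  exists c => y A sA yA; rewrite (ec _ A) // !bil_lin !bil_delta.
  by rewrite -[in A (o j) (o i)]sA mxE; ring.
have [cp ep] := diag 0 2%:R isT; have [cq eq] := diag 1 2%:R isT.
have [cx ex] := offdiag 0 1 isT; have [cz ez] := offdiag 0 2%:R isT.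
have [cw ew] := offdiag 1 2%:R isT.
(* Off-diagonal entries and differences of diagonal entries of the block are unchanged by adding t
   Q0 to A, so they are linear forms in y. *)
pose cub := cubic_minors (lin_mpoly cp) (lin_mpoly cq) (lin_mpoly cx)
  (lin_mpoly cz) (lin_mpoly cw).
have cubE (y : 'rV[C]_n.+1) (A : 'M_k.+1) : A^T = A ->
    (forall i, y 0 i = bil A (ell i) (ell i)) ->
    map (meval (y 0)) cub = cubic_minors (A (o 0) (o 0) - A (o 2%:R) (o 2%:R))
      (A (o 1) (o 1) - A (o 2%:R) (o 2%:R)) (A (o 0) (o 1)) (A (o 0) (o 2%:R))
      (A (o 1) (o 2%:R)).
  move=> sA yA; rewrite map_cubic_minors /=.
  by rewrite (ep _ A) ?(eq _ A) ?(ex _ A) ?(ez _ A) ?(ew _ A).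
exists (lin_eqs ell), (quad_eqs ell vs), cub; split; [split=> //|split|].
- exact: (size_lin_eqs s2 ellQ vsV).
- by apply: (size_quad_eqs_full s2 sk ellQ vsV); rewrite s_3.
- exact: lin_eqs_homog.
- exact: quad_eqs_homog.
- by apply: cubic_minors_homog; apply: lin_mpoly_homog.
move=> y /coord_square_phi2 ->; split=> [[w ->]|[ylin yquad ycub]].
  split=> //; [exact: phi2_vanish_lin|exact: (phi2_vanish_quad vsV)|].
  (* At a point of the image, A can be taken to be w w^T, for which the cubics vanish
     identically. *)
  have ww : (w *m w^T)^T = w *m w^T by rewrite trmx_mul trmxK.
  have yw i : phi2 (embed ell w) 0 i = bil (w *m w^T) (ell i) (ell i).
    by rewrite -[w in w *m _]trmxK bil_rank1 trmxK !mxE expr2; congr (_ * _);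
      apply: eq_bigr => a _; rewrite !mxE mulrC.
  have wE i j : (w *m w^T) i j = w i 0 * w j 0 by rewrite mxE big_ord1 mxE.
  move=> f /(map_f (meval (phi2 (embed ell w) 0))); rewrite (cubE _ _ ww yw) !wE.
  by rewrite /cubic_minors !inE => /orP[|/orP[|/orP[|/orP[|/orP[|/orP[]]]]]] /eqP ->;
    ring.
have [A [sA yA omA]] := zeros_orthogonal_minors ellQ vsV ylin yquad.
apply: (rank1_mod_phi2 ellQ yA); apply: orthogonal_minors_block => //.
set G := pid_mx s; pose B : 'M[C]_3 := \matrix_(i, j) A (o i) (o j).
have [||t [w eB]] := @cubic_minors_rank1_mod C B.
- by apply/matrixP => i j; rewrite !mxE -[in LHS]sA mxE.
- by rewrite !mxE -(cubE y A sA yA) => c /mapP[f fc ->]; apply: ycub.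
(* [G] selects the first s coordinates, so the product is the block [B] up to the identification s =
   3. *)
suff -> : G *m A *m G^T = castmx (esym s_3, esym s_3) B.
  exists t, (castmx (erefl, esym s_3) w); rewrite eB.
  by case: s / (esym s_3); rewrite !castmx_id.
have rG i : row i G = delta_mx 0 (widen_ord sk i).
  by apply/rowP => j; rewrite !mxE -val_eqE /= eq_sym ltn_ord andbT.
apply/matrixP => i j; rewrite castmxE [RHS]mxE -[LHS]bil_delta bil_congr -!rowE.
by rewrite !rG bil_delta; congr (A _ _); apply/val_inj.
Qed.
End CutOut.

Theorem theorem4p11 (R : realType) (n k s : nat)
    (L : {vspace 'rV[R[i]]_n.+1}) (ell : 'I_n.+1 -> 'rV[R[i]]_k.+1)
    (dimL : \dim L = k.+1)
    (embL : linear_embedding_onto L ell)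
    (Zquadric : on_unique_quadric_of_rank (point_configuration ell) s) :
  [/\ (4 <= s)%N ->
        cut_out_by_forms (coord_square L)
          (num_linear n k) (num_quadratic k) 0,
      s = 3%N ->
        cut_out_by_forms (coord_square L)
          (num_linear n k) (num_quadratic k) 7%:R
    & s = 2%N ->
        cut_out_by_forms (coord_square L)
          (num_linear n k) (num_quadratic k + 2%:R) 0].
Proof.
case: Zquadric => Q0 [sQ0 _ rQ0 Q0P]; have [_ ellL] := embL.
have [P uP defP] := congr_pid_mx sQ0; rewrite rQ0 in defP.
have sk : (s <= k.+1)%N by rewrite -rQ0 rank_leq_row.
(* A change of basis of W makes the quadric a sum of s squares and only reparametrizes L. *)
pose ell' i := ell i *m invmx P.
have ellL' x : x \in L <-> exists w, x = embed ell' w.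
  have embE w : embed ell' w = embed ell (invmx P *m w).
    by apply/rowP => i; rewrite [LHS]mxE [RHS]mxE mulmxA.
  rewrite ellL; split=> -[w ->]; last by exists (invmx P *m w); rewrite embE.
  by exists (P *m w); rewrite embE mulKmx.
have ellQ' (Q : 'M[R[i]]_k.+1) : Q^T = Q ->
    ((forall i, bil Q (ell' i) (ell' i) = 0) <-> exists c, Q = c *: pid_mx s).
  move=> sQ; pose N := invmx P *m Q *m (invmx P)^T.
  have sN : N^T = N by rewrite !trmx_mul trmxK sQ mulmxA.
  have NQ : Q = P *m N *m P^T.
    by rewrite /N !mulmxA mulmxV // mul1mx -mulmxA -trmx_mul mulmxV // trmx1 mulmx1.
  have bN i : bil Q (ell' i) (ell' i) = bil N (ell i) (ell i) by rewrite bil_congr.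
  transitivity (quadric_contains N (point_configuration ell)).
    split=> [Q0' p [i _ [c _ ->]]|NZ i].
      by rewrite -/(bil N _ _) bilZl bilZr -bN Q0' !mulr0.
    (* A zero form ell_i gives no point of Z, but every quadratic form vanishes there. *)
    rewrite bN; have [->|nz] := eqVneq (ell i) 0; first by rewrite /bil !mul0mx mxE.
    by apply: NZ; exists i => //; exists 1; rewrite ?oner_neq0 // scale1r.
  rewrite Q0P //; split=> -[c e]; exists c.
    by rewrite NQ e -scalemxAr -scalemxAl defP.
  rewrite /N e -defP -scalemxAr -scalemxAl !mulmxA mulVmx // mul1mx.
  by rewrite -mulmxA -trmx_mul mulVmx // trmx1 mulmx1.
split=> hs.
- exact: (cut_out_rank_ge4 (ltnW (ltnW hs)) sk ellQ' ellL' hs).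
- by apply: (cut_out_rank3 _ sk ellQ' ellL' hs); rewrite hs.
- by apply: (cut_out_rank2 _ sk ellQ' ellL' hs); rewrite hs.
Qed.
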